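(* Let $K$ be a finite field, $\mathbf{F}$ a free group of finite rank $r\ge1$, and $\mathcal{A}=K[\mathbf{F}]$. Assume that $1\ne w\in\mathbf{F}$ is a non-power. Then every cyclic generator of the right $\mathcal{A}$-module $\mathcal{A}_w=\mathcal{A}/(w-1)$ is the image of a unit of $\mathcal{A}$ under the quotient map $\mathcal{A}\to\mathcal{A}_w$.
   Context: $(w-1)=(w-1)\mathcal{A}$ is the right ideal of $\mathcal{A}$ generated by $w-1$, and $\mathcal{A}_w$ is the quotient of the right $\mathcal{A}$-module $\mathcal{A}$ by this submodule. A cyclic generator of $\mathcal{A}_w$ is an element $f\in\mathcal{A}_w$ with $f\mathcal{A}=\mathcal{A}_w$. A non-power is an element not of the form $v^k$ with $v\in\mathbf{F}$ and $k\ge2$. *)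

(* Defs.v *)
From HB Require Import structures.
From mathcomp Require Import all_boot ssralg ring_quotient generic_quotient.
From mathcomp Require Import finmap boolp.
From mathcomp.multinomials Require Import monalg.

Set Implicit Arguments.
Unset Strict Implicit.
Unset Printing Implicit Defensive.

Import GRing.Theory.

(* The free group on T as the set of reduced words: the letter (t, false) is  *)
(* the generator t, and (t, true) is its inverse.                             *)
Section FreeGroup.
Variable T : choiceType.

Local Notation letter := (T * bool)%type.

Implicit Types (a b : letter) (s t u : seq letter).

Definition linv a : letter := (a.1, ~~ a.2).

Lemma linvK : involutive linv.
Proof. by case=> x b; rewrite /linv /= negbK. Qed.

Definition reduced s := sorted (fun a b => b != linv a) s.

Definition push a s :=
  if s is b :: s' then (if b == linv a then s' else a :: s) else [:: a].

Definition wmul s t := foldr push t s.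

Definition winv s := rev (map linv s).

Lemma reduced_behead a s : reduced (a :: s) -> reduced s.
Proof. by case: s => //= b s /andP[]. Qed.

Lemma push_reduced a s : reduced s -> reduced (push a s).
Proof.
case: s => //= b s rs; case: ifP => [_|nba]; first exact: (@reduced_behead b).
by rewrite /= nba.
Qed.

Lemma wmul_reduced s t : reduced t -> reduced (wmul s t).
Proof. by move=> rt; elim: s => //= a s; apply: push_reduced. Qed.

Lemma pushK a s : reduced s -> push (linv a) (push a s) = s.
Proof.
case: s => [|b s] /=; first by rewrite linvK eqxx.
case: eqVneq => [->|_] rs /=; last by rewrite linvK eqxx.
by case: s rs => //= c s /andP[/negbTE->].
Qed.

Lemma pushVK a s : reduced s -> push a (push (linv a) s) = s.
Proof. by move=> rs; rewrite -{1}[a]linvK pushK. Qed.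

Lemma push_cons a s : reduced (a :: s) -> push a s = a :: s.
Proof. by case: s => //= b s /andP[/negbTE->]. Qed.

Lemma wmul_push a s t : reduced t -> wmul (push a s) t = push a (wmul s t).
Proof.
case: s => //= b s rt; case: eqP => //= ->.
by rewrite pushVK // wmul_reduced.
Qed.

Lemma wmulA s t u : reduced u -> wmul s (wmul t u) = wmul (wmul s t) u.
Proof. by move=> ru; elim: s => //= a s ->; rewrite wmul_push. Qed.

Lemma wmuls0 s : reduced s -> wmul s [::] = s.
Proof.
elim: s => //= a s IHs rs.
by rewrite IHs ?push_cons //; apply: reduced_behead rs.
Qed.

Lemma winv_reduced s : reduced s -> reduced (winv s).
Proof.
rewrite /reduced /winv rev_sorted sorted_map.
by apply: sub_sorted => a b /=; rewrite linvK eq_sym.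
Qed.

Lemma winvK : involutive winv.
Proof.
by move=> s; rewrite /winv map_rev revK -map_comp map_id_in // => a _ /=;
  rewrite linvK.
Qed.

Lemma wmulVcat s t : reduced t -> wmul (winv s) (wmul s t) = t.
Proof.
elim: s t => //= a s IHs t rt; rewrite /winv /= rev_cons -cats1.
rewrite [LHS]foldr_cat /= pushK; last exact: wmul_reduced.
exact: IHs.
Qed.

Lemma wmulVs s : reduced s -> wmul (winv s) s = [::].
Proof. by move=> rs; rewrite -{2}[s]wmuls0 // wmulVcat. Qed.

Lemma wmulsV s : reduced s -> wmul s (winv s) = [::].
Proof. by move=> rs; rewrite -{1}[s]winvK wmulVs // winv_reduced. Qed.

Record free_group := FreeGroup { fg_val : seq letter; _ : reduced fg_val }.

HB.instance Definition _ := [isSub for fg_val].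
HB.instance Definition _ := [Choice of free_group by <:].

Implicit Types x y z : free_group.

Definition fg_one : free_group := @FreeGroup [::] isT.
Definition fg_mul x y : free_group :=
  FreeGroup (wmul_reduced (val x) (valP y)).
Definition fg_inv x : free_group := FreeGroup (winv_reduced (valP x)).

Lemma fg_mulA : associative fg_mul.
Proof. by move=> x y z; apply/val_inj; rewrite /= wmulA ?(valP z). Qed.

Lemma fg_mul1 : left_id fg_one fg_mul.
Proof. by move=> x; apply/val_inj. Qed.

Lemma fg_mulr1 : right_id fg_one fg_mul.
Proof. by move=> x; apply/val_inj; rewrite /= wmuls0 ?(valP x). Qed.

Lemma fg_mulV : left_inverse fg_one fg_inv fg_mul.
Proof. by move=> x; apply/val_inj; rewrite /= wmulVs ?(valP x). Qed.

Lemma fg_mulrV : right_inverse fg_one fg_inv fg_mul.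
Proof. by move=> x; apply/val_inj; rewrite /= wmulsV ?(valP x). Qed.

HB.instance Definition _ := isGroup.Build free_group
  fg_mulA fg_mul1 fg_mulr1 fg_mulV fg_mulrV.

Definition fg_gen (t : T) : free_group := @FreeGroup [:: (t, false)] isT.

Section Lift.
Local Open Scope group_scope.
Variables (G : groupType) (f : T -> G).

Definition eval_letter a : G := if a.2 then (f a.1)^-1 else f a.1.
Definition eval_word s : G := foldr (fun a g => eval_letter a * g) 1 s.
Definition fg_lift x : G := eval_word (val x).

Lemma eval_linv a : eval_letter (linv a) = (eval_letter a)^-1.
Proof. by case: a => x [] //=; rewrite /eval_letter /= invgK. Qed.

Lemma eval_push a s : eval_word (push a s) = eval_letter a * eval_word s.
Proof.
by case: s => //= b s; case: eqP => //= ->; rewrite eval_linv mulVKg.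
Qed.

Lemma fg_liftM : {morph fg_lift : x y / x * y}.
Proof.
move=> x y; rewrite /fg_lift /=; elim: (val x) => /= [|a s IHs].
  by rewrite mul1g.
by rewrite eval_push IHs mulgA.
Qed.

HB.instance Definition _ :=
  monoid.isMultiplicative.Build free_group G fg_lift fg_liftM.

Lemma fg_lift_gen (t : T) : fg_lift (fg_gen t) = f t.
Proof. by rewrite /fg_lift /= /eval_letter /= mulg1. Qed.

Lemma fg_lift_uniq (h : {multiplicative free_group -> G}) :
  (forall t : T, h (fg_gen t) = f t) -> h =1 fg_lift.
Proof.
move=> hf; have h1: h 1 = 1.
  by apply: (@mulgI _ (h 1)); rewrite -gmulfM !mulg1.
have hV x: h x^-1 = (h x)^-1.
  by apply: (@mulgI _ (h x)); rewrite -gmulfM !mulgV.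
case; elim=> [|a s IHs] rs; first by rewrite -[RHS]h1; congr (h _); apply/val_inj.
have rs' := reduced_behead rs.
pose c := FreeGroup (isT : reduced [:: a]).
have -> : FreeGroup rs = c * FreeGroup rs'.
  by apply/val_inj; rewrite /= push_cons.
rewrite gmulfM fg_liftM IHs; congr (_ * _).
rewrite /fg_lift /= mulg1 /eval_letter /c; case: (a) => t [] /=.
  by rewrite -hf -hV; congr (h _); apply/val_inj.
by rewrite -hf; congr (h _); apply/val_inj.
Qed.

End Lift.
End FreeGroup.

Definition non_power (G : groupType) (g : G) : Prop :=
  forall (v : G) (k : nat), (2 <= k)%N -> g <> (v ^+ k)%g.

Local Open Scope ring_scope.

(* {malg R[G]} carries the finitely supported functions G -> R as an R-module, *)
(* but the ring structure of the library is restricted to monoids without      *)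
(* nontrivial units, which excludes groups: hence the alias.                   *)
Definition group_algebra (R : nzRingType) (G : groupType) : Type := {malg R[G]}.

Section GroupAlgebraRing.
Variables (R : nzRingType) (G : groupType).
Local Notation A := (group_algebra R G).

HB.instance Definition _ := GRing.Lmodule.on A.

Definition ga_of (g : G) : A := mkmalgU g 1.

Implicit Types a b c : A.

Definition ga_mul a b : A :=
  \sum_(g <- msupp a) \sum_(h <- msupp b)
     mkmalgU (g * h)%g (mcoeff g a * mcoeff h b).

Lemma ga_mulwl (d e : {fset G}) a b :
    (msupp a `<=` d)%fset -> (msupp b `<=` e)%fset ->
  ga_mul a b = \sum_(g <- d) \sum_(h <- e)
     mkmalgU (g * h)%g (mcoeff g a * mcoeff h b).
Proof.
move=> le_d le_e; rewrite /ga_mul (big_fset_incl _ le_d) /=.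
  apply/eq_bigr=> g _; apply/big_fset_incl => // h _ /mcoeff_outdom ->.
  by rewrite mulr0 monalgU0.
move=> g _ /mcoeff_outdom ag; rewrite big1 // => h _.
by rewrite ag mul0r monalgU0.
Qed.

Lemma ga_mulDl : left_distributive ga_mul +%R.
Proof.
move=> a b c; rewrite (ga_mulwl (msuppD_le a b) (fsubset_refl (msupp c))).
rewrite (ga_mulwl (fsubsetUl _ (msupp b)) (fsubset_refl (msupp c))).
rewrite (ga_mulwl (fsubsetUr (msupp a) _) (fsubset_refl (msupp c))).
rewrite -big_split /=; apply/eq_bigr=> g _; rewrite -big_split /=.
by apply/eq_bigr=> h _; rewrite mcoeffD mulrDl monalgUD.
Qed.

Lemma ga_mulDr : right_distributive ga_mul +%R.
Proof.
move=> a b c; rewrite (ga_mulwl (fsubset_refl (msupp a)) (msuppD_le b c)).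
rewrite (ga_mulwl (fsubset_refl (msupp a)) (fsubsetUl _ (msupp c))).
rewrite (ga_mulwl (fsubset_refl (msupp a)) (fsubsetUr (msupp b) _)).
rewrite -big_split /=; apply/eq_bigr=> g _; rewrite -big_split /=.
by apply/eq_bigr=> h _; rewrite mcoeffD mulrDr monalgUD.
Qed.

Lemma ga_mul0l : left_zero 0 ga_mul.
Proof. by move=> a; rewrite /ga_mul msupp0 big_seq_fset0. Qed.

Lemma ga_mul0r : right_zero 0 ga_mul.
Proof.
by move=> a; rewrite /ga_mul big1 // => g _; rewrite msupp0 big_seq_fset0.
Qed.

Lemma ga_mulUU (x y : R) (g h : G) :
  ga_mul (mkmalgU g x) (mkmalgU h y) = mkmalgU (g * h)%g (x * y).
Proof. by rewrite (ga_mulwl msuppU_le msuppU_le) !big_seq_fset1 !mcoeffUU. Qed.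

Lemma ga_mul_suml I (r : seq I) (F : I -> A) b :
  ga_mul (\sum_(i <- r) F i) b = \sum_(i <- r) ga_mul (F i) b.
Proof.
exact: (big_morph (ga_mul^~ b) (fun _ _ => ga_mulDl _ _ _) (ga_mul0l b)).
Qed.

Lemma ga_mul_sumr I (r : seq I) (F : I -> A) b :
  ga_mul b (\sum_(i <- r) F i) = \sum_(i <- r) ga_mul b (F i).
Proof.
exact: (big_morph (ga_mul b) (fun _ _ => ga_mulDr _ _ _) (ga_mul0r b)).
Qed.

Lemma ga_mulA : associative ga_mul.
Proof.
move=> a b c; rewrite [a]monalgE.
rewrite ga_mul_suml (ga_mul_suml _ _ b) (ga_mul_suml _ _ c).
apply/eq_bigr=> g _; rewrite [b]monalgE.
rewrite (ga_mul_suml _ _ c) !ga_mul_sumr (ga_mul_suml _ _ c).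
apply/eq_bigr=> h _; rewrite ga_mulUU [c]monalgE.
rewrite (ga_mul_sumr _ _ (mkmalgU h _)) !ga_mul_sumr.
apply/eq_bigr=> k _.
by rewrite !ga_mulUU mulrA mulgA.
Qed.

Lemma ga_mul1 : left_id (ga_of 1%g) ga_mul.
Proof.
move=> a; rewrite [a]monalgE ga_mul_sumr; apply/eq_bigr=> g _.
by rewrite ga_mulUU mul1r mul1g.
Qed.

Lemma ga_mulr1 : right_id (ga_of 1%g) ga_mul.
Proof.
move=> a; rewrite [a]monalgE ga_mul_suml; apply/eq_bigr=> g _.
by rewrite ga_mulUU mulr1 mulg1.
Qed.

Lemma ga_one_neq0 : ga_of 1%g != 0.
Proof. by rewrite monalgU_eq0 oner_eq0. Qed.

HB.instance Definition _ := GRing.Zmodule_isNzRing.Build A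
  ga_mulA ga_mul1 ga_mulr1 ga_mulDl ga_mulDr ga_one_neq0.

Lemma ga_ofM : {morph ga_of : g h / (g * h)%g >-> g * h}.
Proof. by move=> g h; rewrite [RHS]ga_mulUU mulr1. Qed.

Lemma ga_of1 : ga_of 1%g = 1.
Proof. by []. Qed.

Lemma ga_scaleAl (x : R) a b : x *: (a * b) = (x *: a) * b.
Proof.
have scaleE (c : A) : x *: c = ga_mul (mkmalgU 1%g x) c.
  rewrite [c in RHS]monalgE ga_mul_sumr.
  by apply/eq_bigr => g _; rewrite ga_mulUU mul1g.
by rewrite !scaleE ga_mulA.
Qed.

HB.instance Definition _ := GRing.Lmodule_isLalgebra.Build R A ga_scaleAl.

Definition ga_unit : {pred A} :=
  fun a => `[< exists b, b * a = 1 /\ a * b = 1 >].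

Definition ga_inv a : A :=
  if pselect (exists b, b * a = 1 /\ a * b = 1) is left e
  then projT1 (cid e) else a.

Lemma ga_invP a : a \in ga_unit -> ga_inv a * a = 1 /\ a * ga_inv a = 1.
Proof.
move=> /asboolP ua; rewrite /ga_inv; case: pselect => // e.
by case: (cid e).
Qed.

Lemma ga_mulVr : {in ga_unit, left_inverse 1 ga_inv *%R}.
Proof. by move=> a /ga_invP[]. Qed.

Lemma ga_mulrV : {in ga_unit, right_inverse 1 ga_inv *%R}.
Proof. by move=> a /ga_invP[]. Qed.

Lemma ga_unitP a b : b * a = 1 /\ a * b = 1 -> a \in ga_unit.
Proof. by move=> ba; apply/asboolP; exists b. Qed.

Lemma ga_inv_out : {in [predC ga_unit], ga_inv =1 id}.
Proof.
move=> a /asboolP nua; rewrite /ga_inv; by case: pselect.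
Qed.

HB.instance Definition _ := GRing.NzRing_hasMulInverse.Build A
  ga_mulVr ga_mulrV ga_unitP ga_inv_out.

End GroupAlgebraRing.

Section GroupAlgebraCom.
Variables (R : comNzRingType) (G : groupType).
Local Notation A := (group_algebra R G).

Lemma ga_scaleAr (x : R) (a b : A) : x *: (a * b) = a * (x *: b).
Proof.
have scaleE (c : A) : x *: c = c * (mkmalgU 1%g x : A).
  rewrite [c in RHS]monalgE [RHS]ga_mul_suml.
  by apply/eq_bigr => g _; rewrite ga_mulUU mulg1 mulrC.
by rewrite !scaleE mulrA.
Qed.

HB.instance Definition _ := GRing.Lalgebra_isAlgebra.Build R A ga_scaleAr.

End GroupAlgebraCom.

(* Right R-modules are left modules over the converse ring R^c, so that m r is *)
(* written r *: m (see rprojM).                                                *)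
Section RightModules.
Variable R : nzRingType.

Definition principal_rideal (a : R) : {pred R} :=
  fun x => `[< exists b, x = a * b >].

Lemma principal_rideal_closed a : zmod_closed (principal_rideal a).
Proof.
split; first by apply/asboolP; exists 0; rewrite mulr0.
move=> _ _ /asboolP[b ->] /asboolP[c ->].
by apply/asboolP; exists (b - c); rewrite mulrBr.
Qed.

HB.instance Definition _ a :=
  GRing.isZmodClosed.Build R (principal_rideal a) (principal_rideal_closed a).

Definition rquot (a : R) : Type := Quotient.quot (principal_rideal a).

HB.instance Definition _ a := GRing.Zmodule.on (rquot a).
HB.instance Definition _ a := Quotient.on (rquot a).

Definition rproj (a : R) (x : R) : rquot a := (\pi_(rquot a) x)%qT.

Lemma rproj_eq a x y : rproj a x = rproj a y <-> exists b, x - y = a * b.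
Proof.
rewrite /rproj; split=> [/eqP|e].
  by rewrite -Quotient.idealrBE => /asboolP.
by apply/eqP; rewrite -Quotient.idealrBE; apply/asboolP.
Qed.

Lemma rproj_surj a (m : rquot a) : exists x, m = rproj a x.
Proof. by exists (repr m); rewrite /rproj reprK. Qed.

Lemma rprojD a : {morph rproj a : x y / x + y}.
Proof. by move=> x y; rewrite /rproj !piE. Qed.

Definition rquot_scale a (r : R^c) (m : rquot a) : rquot a :=
  rproj a (repr m * (r : R)).

Lemma rquot_scaleE a (r : R^c) x :
  rquot_scale r (rproj a x) = rproj a (x * (r : R)).
Proof.
apply/rproj_eq; rewrite -mulrBl.
have /rproj_eq[b ->] : rproj a (repr (rproj a x)) = rproj a x.
  by rewrite /rproj reprK.
by exists (b * (r : R)); rewrite mulrA.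
Qed.

Lemma rquot_scaleA a (r s : R^c) (m : rquot a) :
  rquot_scale r (rquot_scale s m) = rquot_scale (r * s) m.
Proof. by case: (rproj_surj m) => x ->; rewrite !rquot_scaleE -mulrA. Qed.

Lemma rquot_scale1 a : left_id (1 : R^c) (@rquot_scale a).
Proof. by move=> m; case: (rproj_surj m) => x ->; rewrite rquot_scaleE mulr1. Qed.

Lemma rquot_scaleDr a : right_distributive (@rquot_scale a) +%R.
Proof.
move=> r m n; case: (rproj_surj m) (rproj_surj n) => x -> [y ->].
by rewrite -rprojD !rquot_scaleE mulrDl rprojD.
Qed.

Lemma rquot_scaleDl a (m : rquot a) :
  {morph (@rquot_scale a)^~ m : r s / r + s}.
Proof.
move=> r s; case: (rproj_surj m) => x ->.
by rewrite !rquot_scaleE mulrDr rprojD.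
Qed.

HB.instance Definition _ a := GRing.Zmodule_isLmodule.Build R^c (rquot a)
  (@rquot_scaleA a) (@rquot_scale1 a) (@rquot_scaleDr a) (@rquot_scaleDl a).

Lemma rprojM a x y : rproj a (x * y) = (y : R^c) *: rproj a x.
Proof. by rewrite [RHS]rquot_scaleE. Qed.

Definition cyclic_generator (M : lmodType R^c) (f : M) : Prop :=
  forall m : M, exists r : R^c, m = r *: f.

End RightModules.

(* Main.v *)
Require Import Defs.
From mathcomp Require Import all_boot all_order all_algebra.
From mathcomp Require Import finmap boolp zify ring.
From mathcomp.multinomials Require Import monalg.

(** Write A = K[F] and b = w - 1. If the class of f generates A / bA, then
    f p + b q = 1 for some p and q. The claim is that f lies in c m + bA for a
    nonzero scalar c and an element m of F; the unit is then c m. It is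
    harmless to replace f by a congruent element whose support meets each right
    coset <w>g at most once, and to multiply f by a group element so that 1 lies
    in the support (distinct_cosets_representative, generator_trivial_unit). The
    goal becomes: the support of f is {1}.

    The row (f, b) is unimodular, and over the group algebra of a free group
    such a row completes to an invertible 2 x 2 matrix
    (unimodular_completion). The proof is a finite-dimensional argument on a
    finite subtree of the Cayley graph that carries the supports. Consequently
    {x | f x in bA} is a principal right ideal h A, and p f + h g = 1,
    p b = h r after a change of p. All these elements can be taken in K[H],
    where H is generated by w and the support of f (annihilator_supported).

    Let phi : H -> Z be a homomorphism that kills w. From the two relations,
    h (g - r (1 + w + ... + w^(N-1)) f) = 1 - p w^N f, so h has the formal right
    inverse Q = g - r (1 + w + w^2 + ...) f. A free group is bi-ordered
    (magnus_pos_cone); refine phi, and also - phi, lexicographically by an order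
    in which w is positive. For such an order the supports of h and of Q have
    least elements, and these are inverse to each other because a product of
    least terms never cancels. Comparing both orders shows that phi is constant
    on the support of h (annihilator_homogeneous).

    Hence h is homogeneous for phi, and the part u of f on which phi vanishes
    still satisfies u h in bA. Then u p b is in bA: the class of u p in A / bA
    is fixed by w. Because w is a non-power, the only fixed classes are those of
    scalars (fixed_scalar), so u is congruent to c f. By the normalization of
    the support u = f, that is, phi vanishes on the support of f and so on H
    (hom_vanishes).

    A subgroup of a free group on which every homomorphism to Z that kills w is
    zero consists of roots of powers of w (isolator). Such roots commute with w,
    and the centralizer of a non-power w is <w> (non_power_centralizer). So the
    support of f lies in <w>, and it is {1}. *)

Set Implicit Arguments.
Unset Strict Implicit.
Unset Printing Implicit Defensive.

Import GRing.Theory Num.Theory Order.TTheory.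
Local Open Scope ring_scope.

(** * The Magnus expansion of a free group *)

Section Magnus.
Variable T : countType.
Local Notation F := (free_group T).
Local Notation ser := (seq T -> int).
Implicit Types (a b c : ser) (s t u : seq T) (x y : T) (l : T * bool) (g h : F).

(** Power series in noncommuting variables with integer coefficients are
    functions on the words in the variables. The product is computed by
    removing the first letter of the word, which makes the left derivative sder
    the natural recursion step. *)
Definition sder x a : ser := fun s => a (x :: s).
Fixpoint smul a b s : int :=
  a [::] * b s + if s is x :: s' then smul (sder x a) b s' else 0.
Definition sone : ser := fun s => (s == [::])%:R.

Lemma smulDl a b c s : smul (fun t => a t + b t) c s = smul a c s + smul b c s.
Proof. elim: s a b => [|x s IH] a b /=; [by ring | by rewrite /sder IH /sder; ring]. Qed.

Lemma smulZl (z : int) a b s : smul (fun t => z * a t) b s = z * smul a b s.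
Proof. elim: s a => [|x s IH] a /=; [by ring | by rewrite /sder IH /sder; ring]. Qed.

Lemma smulA a b c : smul a (smul b c) = smul (smul a b) c.
Proof.
apply/funext => s; elim: s a b => [|x s IH] a b /=; first by ring.
rewrite IH.
have -> : sder x (smul a b) =
    (fun t => a [::] * sder x b t + smul (sder x a) b t) by [].
by rewrite smulDl smulZl; ring.
Qed.

Lemma smul0l a s : smul (fun=> 0) a s = 0.
Proof. by rewrite -[RHS](mul0r (smul (fun=> 0) a s)) -smulZl; congr smul; apply/funext=> t; rewrite mul0r. Qed.

Lemma smul1l a : smul sone a = a.
Proof.
apply/funext => -[|x s] /=; first by rewrite mul1r addr0.
have -> : sder x sone = fun=> 0 by [].
by rewrite smul0l mul1r addr0.
Qed.

(** The image of a letter: 1 + x for a generator x, and the geometric series of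
    - x for its inverse. *)
Definition mletter l : ser := fun s =>
  if l.2 then (all (pred1 l.1) s)%:R * (-1) ^+ size s
  else ((s == [::]) || (s == [:: l.1]))%:R.

Lemma mletter_der l y : y != l.1 -> sder y (mletter l) = fun=> 0.
Proof.
move=> ny; apply/funext => s; rewrite /sder /mletter /= (negbTE ny) /=.
by case: l.2; rewrite ?mul0r // eqseq_cons (negbTE ny).
Qed.

Lemma mletter_derV x : sder x (mletter (x, true)) = fun s => (-1) * mletter (x, true) s.
Proof.
by apply/funext=> s; rewrite /sder /mletter /= eqxx /= exprS; ring.
Qed.

Lemma mletter_derP x : sder x (mletter (x, false)) = sone.
Proof. by apply/funext=> s; rewrite /sder /mletter /sone /= eqseq_cons eqxx. Qed.

Lemma mletter0 l : mletter l [::] = 1.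
Proof. by rewrite /mletter /=; case: l.2. Qed.

Lemma smul_letter l a s :
  smul (mletter l) a s = a s +
    if s is x :: s' then if x == l.1 then
       if l.2 then - smul (mletter l) a s' else a s' else 0 else 0.
Proof.
case: s => [|x s] /=; rewrite mletter0 mul1r //; congr (_ + _).
case: eqP => [->|/eqP nx]; last by rewrite mletter_der ?smul0l.
case: l => z [] /=; last by rewrite mletter_derP smul1l.
by rewrite mletter_derV smulZl mulN1r.
Qed.

Lemma mletterK l : smul (mletter l) (mletter (linv l)) = sone.
Proof.
apply/funext=> s; elim: s => [|x s IH].
  by rewrite smul_letter !mletter0 addr0.
rewrite smul_letter IH; case: eqP => [->|/eqP nx]; last first.
  rewrite addr0 [LHS](_ : _ = sder x (mletter (linv l)) s) //.
  by rewrite mletter_der.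
rewrite [X in X + _](_ : _ = sder l.1 (mletter (linv l)) s) //.
case: l {IH} => z [] /=; first by rewrite mletter_derP /sone /= addrN.
by rewrite mletter_derV mulN1r addNr.
Qed.

Definition mword (v : seq (T * bool)) : ser := foldr (fun l a => smul (mletter l) a) sone v.

(** The Magnus embedding of the free group into the units of the ring of power
    series. *)
Definition magnus (g : F) : ser := mword (val g).

Lemma mword_push l v : mword (push l v) = smul (mletter l) (mword v).
Proof.
case: v => //= l' v; case: eqP => //= ->.
by rewrite smulA mletterK smul1l.
Qed.

Lemma magnusM (g h : F) : magnus (g * h)%g = smul (magnus g) (magnus h).
Proof.
rewrite /magnus /=; elim: (val g) => [|l v IH] /=; first by rewrite smul1l.
by rewrite mword_push IH smulA.
Qed.

Lemma magnus1 : magnus 1%g = sone. Proof. by []. Qed.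

Lemma magnus_nil (g : F) : magnus g [::] = 1.
Proof.
rewrite /magnus; elim: (val g) => //= l v IH.
by rewrite mletter0 IH.
Qed.

Definition alt s := sorted (fun x y => x != y) s.

Definition add_syllable (l : T * bool) u := if ohead u == Some l.1 then u else l.1 :: u.

(** The variables of a word, one for each maximal run of letters with the same
    variable. The coefficient of the Magnus series at this word is what shows
    that the series is not 1. *)
Definition syllables (v : seq (T * bool)) : seq T := foldr add_syllable [::] v.

Lemma alt_behead x s : alt (x :: s) -> alt s.
Proof. by case: s => //= y s /andP[]. Qed.

Lemma smul_letter_alt x (b : bool) a s : alt (x :: s) ->
  smul (mletter (x, b)) a (x :: s) = a (x :: s) + (-1) ^+ b * a s.
Proof.
move=> As; rewrite smul_letter /= eqxx; congr (_ + _).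
case: b; last by rewrite mul1r.
rewrite smul_letter; case: s As => [|y s] /=; first by rewrite expr1 mulN1r addr0.
by rewrite eq_sym => /andP[/negbTE -> _]; rewrite addr0 expr1 mulN1r.
Qed.

Lemma smul_letter_neq x y (b : bool) a s : y != x ->
  smul (mletter (x, b)) a (y :: s) = a (y :: s).
Proof. by move=> nyx; rewrite smul_letter /= (negbTE nyx) addr0. Qed.

(** An alternating word takes at most one variable from each syllable of v, so
    it cannot be longer than the list of syllables, and with equal lengths it
    is that list. *)
Lemma mword_alt_vanish v u : alt u ->
    (size (syllables v) < size u)%N ||
      ((size (syllables v) == size u) && (ohead (syllables v) != ohead u)) ->
  mword v u = 0.
Proof.
elim: v u => [|[x b] v IH] u Au; first by case: u Au.
rewrite [syllables _]/= -/(syllables v) [mword _]/=.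
case: u Au => [|y u] Au.
  rewrite /add_syllable; case: ifP; first by case: (syllables v).
  by [].
have [eyx|nyx] := eqVneq y x; last first.
  rewrite smul_letter_neq // => h; apply: IH => //; move: h.
  rewrite /add_syllable /=; case: eqP => [->|_] /=; last by lia.
  by lia.
subst y; rewrite smul_letter_alt // /add_syllable /=; case: eqP => [ex|nx] /=.
  rewrite ex eqxx andbF orbF => h; rewrite !IH ?h ?mulr0 ?addr0 //.
    exact: alt_behead Au.
  have : (size (syllables v) <= size u)%N by lia.
  rewrite leq_eqVlt => /orP[/eqP e|->//]; rewrite e eqxx /= ex orbC /=.
  case: u Au {h} e => [|z u] /=; first by case: (syllables v) ex.
  by case/andP=> nz _ _; apply/orP; left; apply: contra nz => /eqP [->].
rewrite eqxx andbF orbF => h; rewrite !IH ?mulr0 ?addr0 //; try (move=> /=; lia).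
exact: alt_behead Au.
Qed.

Lemma syllables_alt v : alt (syllables v).
Proof.
elim: v => //= l v; rewrite /add_syllable; case: (syllables v) => [|y u] //= A.
by case: eqP => [//|ne] /=; rewrite A andbT; apply/eqP => e; apply: ne; rewrite e.
Qed.

(** The coefficient at the syllable word is, up to sign, the product of the
    lengths of the syllables. The induction keeps the length e.+1 of the first
    syllable apart because the next letter may prolong it. *)
Lemma mword_syllables x (b : bool) v : reduced ((x, b) :: v) ->
  exists u (c : int) (e : nat),
  [/\ syllables ((x, b) :: v) = x :: u, c != 0, mword ((x, b) :: v) u = c &
      mword ((x, b) :: v) (x :: u) = (-1) ^+ b * c * e.+1%:Z].
Proof.
elim: v x b => [|[y b'] v IH] x b rv.
  exists [::], 1, 0%N; split=> //; first by rewrite /= mletter0.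
  by rewrite [mword _]/= smul_letter_alt // /sone /=; ring.
have [u [c [e [eu c0 mu mxu]]]] := IH _ _ (reduced_behead rv).
set v' := _ :: v in eu mu mxu rv *.
rewrite (_ : syllables ((x, b) :: v') = add_syllable (x, b) (syllables v')) //.
rewrite (_ : mword ((x, b) :: v') = smul (mletter (x, b)) (mword v')) //.
rewrite eu (_ : add_syllable (x, b) (y :: u) =
  if Some y == Some x then y :: u else [:: x, y & u]) //.
have Axu : alt (syllables v') by apply: syllables_alt.
rewrite eu in Axu.
have [eyx|nyx] := eqVneq y x.
  subst y; rewrite eqxx; exists u, c, e.+1; split=> //.
    case: u Axu mu {eu mxu} => [|z u]; first by move=> _ <-; rewrite [LHS]/= mletter0 mul1r addr0.
    by case/andP => nxz _ <-; rewrite smul_letter /= eq_sym (negbTE nxz) addr0.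
  have eb : b' = b.
    by move: rv; rewrite /v' /reduced /= xpair_eqE eqxx /= => /andP[]; case: (b); case: (b').
  by rewrite smul_letter_alt // mxu mu eb -(addn1 e.+1) PoszD; ring.
rewrite [Some y == Some x](negbTE nyx).
have Ayu : alt (x :: y :: u) by rewrite /= eq_sym nyx.
exists (y :: u), (mword v' (y :: u)), 0%N; split=> //.
- by rewrite mxu !mulf_neq0 // signr_eq0.
- by rewrite smul_letter_neq.
- rewrite smul_letter_alt // mword_alt_vanish ?add0r ?mulr1 //.
  by rewrite eu /= ltnSn.
Qed.

Lemma magnus_faithful (g : F) : g <> 1%g -> exists s, s <> [::] /\ magnus g s != 0.
Proof.
case: g => -[|[x b] v] rv g1; first by case: g1; apply/val_inj.
have [u [c [e [_ c0 _ m]]]] := mword_syllables rv.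
by exists (x :: u); split=> //; rewrite (_ : magnus _ = mword ((x, b) :: v)) // m !mulf_neq0 // signr_eq0.
Qed.

(** Congruence of Magnus series modulo words of length at least k. The elements
    congruent to 1 are the k-th term of a central filtration of the free group.
    *)
Definition magnus_eq k (g h : F) := forall s, (size s < k)%N -> magnus g s = magnus h s.

Lemma smul_diffl a a' b b' s : b [::] = 1 -> b' [::] = 1 ->
  (forall u, (size u < size s)%N -> a u = a' u) ->
  (forall u, (size u <= size s)%N -> b u = b' u) ->
  smul a b s - smul a' b' s = a s - a' s.
Proof.
move=> b1 b1'; elim: s a a' => [|x s IH] a a' ea eb /=.
  by rewrite b1 b1' !mulr1 !addr0.
rewrite (ea [::]) // (eb (x :: s)) // opprD addrACA subrr add0r.
rewrite [_ - _](IH (sder x a) (sder x a')) // => u hu; last by apply: eb; rewrite (leq_trans hu).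
exact: ea.
Qed.

Lemma smul_diff a a' b b' s : s <> [::] -> a [::] = 1 -> a' [::] = 1 ->
   b [::] = 1 -> b' [::] = 1 ->
  (forall u, (size u < size s)%N -> a u = a' u) ->
  (forall u, (size u < size s)%N -> b u = b' u) ->
  smul a b s - smul a' b' s = (a s - a' s) + (b s - b' s).
Proof.
case: s => // x s _ a1 a1' b1 b1' ea eb /=; rewrite a1 a1' !mul1r.
rewrite opprD addrACA smul_diffl // => [|u hu]; first by rewrite /sder addrC.
exact: ea.
Qed.

(** At the first length where two pairs of factors may differ the constant
    terms 1 make the product additive. *)
Lemma magnus_diff g g' h h' s : s <> [::] ->
    magnus_eq (size s) g g' -> magnus_eq (size s) h h' ->
  magnus (g * h)%g s - magnus (g' * h')%g s = (magnus g s - magnus g' s) + (magnus h s - magnus h' s).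
Proof. by move=> s0 eg eh; rewrite !magnusM smul_diff ?magnus_nil. Qed.

Lemma smul_cong a a' b b' s :
  (forall u, (size u <= size s)%N -> a u = a' u) ->
  (forall u, (size u <= size s)%N -> b u = b' u) -> smul a b s = smul a' b' s.
Proof.
elim: s a a' => [|x s IH] a a' ea eb /=; rewrite ea // eb //; congr (_ + _).
by apply: IH => u hu; [exact: ea | apply: eb; apply: leqW].
Qed.

Lemma magnus_eqM k g g' h h' : magnus_eq k g g' -> magnus_eq k h h' ->
  magnus_eq k (g * h)%g (g' * h')%g.
Proof.
move=> eg eh s ss; rewrite !magnusM; apply: smul_cong => u hu.
  by apply: eg; apply: leq_ltn_trans hu ss.
by apply: eh; apply: leq_ltn_trans hu ss.
Qed.

Lemma magnus_eqX k g g' n : magnus_eq k g g' -> magnus_eq k (g ^+ n)%g (g' ^+ n)%g.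
Proof.
move=> e; elim: n => [|n IH]; first by rewrite !expg0.
by rewrite !expgS; apply: magnus_eqM.
Qed.

Lemma magnus_eq_sym k g g' : magnus_eq k g g' -> magnus_eq k g' g.
Proof. by move=> e s /e. Qed.
Lemma magnus_eq_trans k g g' g'' : magnus_eq k g g' -> magnus_eq k g' g'' -> magnus_eq k g g''.
Proof. by move=> e e' s hs; rewrite e // e'. Qed.

Lemma magnus_eq_le k k' g g' : (k <= k')%N -> magnus_eq k' g g' -> magnus_eq k g g'.
Proof. by move=> le e s hs; apply: e; apply: leq_trans hs le. Qed.

Lemma magnus_eqP g g' : (forall k, magnus_eq k g g') -> g = g'.
Proof.
move=> e; suff : (g * g'^-1)%g = 1%g by apply: divg1_eq.
apply: contrapT => /magnus_faithful[s [s0]]; rewrite (_ : magnus _ s = 0) ?eqxx //.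
transitivity (magnus (g' * g'^-1)%g s); last by rewrite mulgV magnus1; case: s s0.
by apply: (@magnus_eqM (size s).+1) => //; apply: e.
Qed.

Lemma magnus_diffX g g' n s : s <> [::] -> magnus_eq (size s) g g' ->
  magnus (g ^+ n)%g s - magnus (g' ^+ n)%g s = n%:Z * (magnus g s - magnus g' s).
Proof.
move=> s0 e; elim: n => [|n IH]; first by rewrite !expg0 subrr mul0r.
by rewrite !expgS magnus_diff ?IH //; [lia | exact: magnus_eqX].
Qed.

(** By additivity, at the first length where the elements may differ the
    coefficients of their n-th powers differ by n times as much, and n is not a
    zero divisor in the integers. *)
Lemma magnus_eq_root k g g' n : (0 < n)%N ->
  magnus_eq k (g ^+ n)%g (g' ^+ n)%g -> magnus_eq k g g'.
Proof.
move=> n0; elim: k => [|k IH] e //.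
have ek : magnus_eq k g g' by apply: IH; apply: magnus_eq_le e.
move=> s; rewrite ltnS leq_eqVlt => /orP[/eqP ss|]; last exact: ek.
case: s ss => [|x s] ss; first by rewrite !magnus_nil.
have s0 : x :: s <> [::] by [].
rewrite -ss in ek e; have := magnus_diffX n s0 ek.
rewrite e // subrr.
by move/esym/eqP; rewrite mulf_eq0 subr_eq0 => /orP[|/eqP//]; lia.
Qed.

Lemma fg_root_inj g g' n : (0 < n)%N -> (g ^+ n)%g = (g' ^+ n)%g -> g = g'.
Proof. by move=> n0 e; apply: magnus_eqP => k; apply: magnus_eq_root n0 _; rewrite e. Qed.

Lemma fg_commute_root g h n : (0 < n)%N -> commute (g ^+ n)%g h -> commute g h.
Proof.
move=> n0 c; have e : (g ^ h)%g = g.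
  apply: (fg_root_inj n0); rewrite -conjXg /conjg c; exact: mulKg.
by rewrite /commute (conjgC g h) e.
Qed.

Lemma magnus_eq1J k g h : magnus_eq k g 1%g -> magnus_eq k (g ^ h)%g 1%g.
Proof.
move=> e; have := magnus_eqM (fun s _ => erefl : magnus h^-1%g s = _) (magnus_eqM e (fun s _ => erefl : magnus h s = _)).
by rewrite mul1g mulVg; apply.
Qed.

Lemma magnus_conj g h s : s <> [::] -> magnus_eq (size s) g 1%g ->
  magnus (g ^ h)%g s = magnus g s.
Proof.
move=> s0 e.
have rfl : magnus_eq (size s) h h by [].
have := magnus_diff s0 rfl (magnus_eq1J h e); rewrite -conjgC mulg1 subrr add0r.
have := magnus_diff s0 e rfl; rewrite mul1g subrr addr0 => ->.
by move/addIr.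
Qed.

Lemma magnus_eq1_add g h s : s <> [::] -> magnus_eq (size s) g 1%g -> magnus_eq (size s) h 1%g ->
  magnus (g * h)%g s = magnus g s + magnus h s.
Proof.
move=> s0 eg eh; have := magnus_diff s0 eg eh; rewrite mulg1 magnus1 /sone.
by case: s s0 {eg eh} => // x s _ /=; rewrite !subr0.
Qed.

Lemma magnus_eq1V k g : magnus_eq k g 1%g -> magnus_eq k g^-1%g 1%g.
Proof.
move=> e; have rfl : magnus_eq k g^-1%g g^-1%g by [].
by have := magnus_eqM e rfl; rewrite mulgV mul1g => /magnus_eq_sym.
Qed.

(** The word s is a shortest nonempty word in the Magnus series of g; its
    coefficient is additive, conjugation invariant and nonzero, and serves
    below as a height on the powers of g. *)
Lemma magnus_depth g : g <> 1%g ->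
  exists s, [/\ s <> [::], magnus g s != 0 & magnus_eq (size s) g 1%g].
Proof.
move=> g1; have [s0 [s0n ms0]] := magnus_faithful g1.
pose P n := `[< exists s, [/\ size s = n, s <> [::] & magnus g s != 0] >].
have exP : exists n, P n by exists (size s0); apply/asboolP; exists s0.
case: (ex_minnP exP) => n /asboolP[s [ss sn ms]] min_n; exists s; split=> // u.
rewrite ss => hu; case: u hu => [|x u] hu; first by rewrite !magnus_nil.
rewrite magnus1 /sone /=; apply/eqP; apply: contraTT hu => mu.
by rewrite -leqNgt; apply: min_n; apply/asboolP; exists (x :: u).
Qed.
End Magnus.

(** * Integral powers *)

Section Zpow.
Variable G : groupType.
Implicit Types (x : G) (z : int).
Local Open Scope group_scope.

Definition zpow x z := match z with Posz n => x ^+ n | Negz n => x ^- n.+1 end.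

Lemma zpowB x m n : zpow x (m%:Z - n%:Z)%R = x ^+ m * x ^- n.
Proof.
have [le|lt] := leqP n m.
  have -> : (m%:Z - n%:Z)%R = (m - n)%N by lia.
  by rewrite /= expgnFr.
have -> : (m%:Z - n%:Z)%R = Negz (n - m).-1 by lia.
have e : n = (n - m + m)%N by lia.
rewrite /= prednK ?subn_gt0 // {2}e expgnDr invgM mulgA.
by rewrite mulgV mul1g.
Qed.

Lemma zpowE x z : exists m n, z = (m%:Z - n%:Z)%R /\ zpow x z = x ^+ m * x ^- n.
Proof.
case: z => n; first by exists n, 0%N; rewrite subr0 expg0 invg1 mulg1.
by exists 0%N, n.+1; rewrite expg0 mul1g; split=> //; lia.
Qed.

Lemma zpowD x z1 z2 : zpow x (z1 + z2)%R = zpow x z1 * zpow x z2.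
Proof.
have [m1 [n1 [-> ->]]] := zpowE x z1; have [m2 [n2 [-> ->]]] := zpowE x z2.
have -> : (m1%:Z - n1%:Z + (m2%:Z - n2%:Z))%R = ((m1 + m2)%N%:Z - (n1 + n2)%N%:Z)%R by lia.
rewrite zpowB expgnDr addnC expgnDr invgM !mulgA; congr (_ * _).
rewrite -!mulgA; congr (_ * _).
have c : commute (x ^+ m2) (x ^- n1) by apply/commuteV/commuteX2.
by rewrite c.
Qed.

Lemma zpowX x (n : nat) : zpow x n%:Z = x ^+ n. Proof. by []. Qed.
Lemma zpow0 x : zpow x 0%R = 1. Proof. by []. Qed.
Lemma zpow1 x : zpow x 1%R = x. Proof. by []. Qed.
Lemma zpowN x z : zpow x (- z)%R = (zpow x z)^-1.
Proof. by apply/esym/mulg1_eq; rewrite -zpowD subrr. Qed.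

Lemma zpowXn x z n : zpow x (z * n%:Z)%R = zpow x z ^+ n.
Proof.
elim: n => [|n IH]; first by rewrite mulr0 expg0.
by rewrite intS mulrDr mulr1 zpowD IH expgS.
Qed.

Lemma zpowM x z1 z2 : zpow x (z1 * z2)%R = zpow (zpow x z1) z2.
Proof.
case: z2 => n; first exact: zpowXn.
by rewrite NegzE mulrN !zpowN zpowXn.
Qed.
End Zpow.

(** * A bi-order on a free group *)

Record subgroup (G : groupType) (H : pred G) : Prop := Subgroup {
  subg1 : H 1%g;
  subgM : forall x y, H x -> H y -> H (x * y)%g;
  subgV : forall x, H x -> H x^-1%g }.

(** The positive cone of a total bi-order on the subgroup H: the order relates
    x and y when x^-1 * y lies in P. *)
Record cone (G : groupType) (H : pred G) (P : G -> Prop) : Prop := Cone {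
  cone1 : ~ P 1%g;
  coneM : forall x y, H x -> H y -> P x -> P y -> P (x * y)%g;
  coneJ : forall x y, H x -> H y -> P x -> P (x ^ y)%g;
  coneT : forall x, H x -> [\/ x = 1%g, P x | P x^-1%g] }.

Section Positive.
Variable T : countType.
Local Notation F := (free_group T).
Implicit Types (g h : F) (s t u : seq T).

(** An element is positive when its leading coefficient is, the leading word
    being the shortest one, and among those the first in some enumeration of
    the words. *)
Definition magnus_pos g := exists s, [/\ s <> [::], magnus_eq (size s) g 1%g,
  forall t, size t = size s -> (choice.pickle t < choice.pickle s)%N -> magnus g t = 0 & 0 < magnus g s].

Lemma size_neq0 s t : s <> [::] -> size t = size s -> t <> [::].
Proof. by case: s t => [|x s] [|y t]. Qed.

Lemma magnus_eq1_0 k g t : magnus_eq k g 1%g -> t <> [::] -> (size t < k)%N -> magnus g t = 0.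
Proof. by move=> e t0 /e ->; rewrite magnus1 /sone; case: t t0. Qed.

Lemma magnus_posM g h : magnus_pos g -> magnus_pos h -> magnus_pos (g * h)%g.
Proof.
move=> [s [s0 es ls ms]] [u [u0 eu lu mu]].
have mul1 (k : nat) (x y : F) : magnus_eq k x 1%g -> magnus_eq k y 1%g -> magnus_eq k (x * y)%g 1%g.
  by move=> ex ey; have := magnus_eqM ex ey; rewrite mulg1.
case: (ltngtP (size s) (size u)) => [lt|gt|eq].
- have eh := magnus_eq_le (ltnW lt) eu.
  exists s; split=> //; first exact: mul1.
    move=> t ts tp; have t0 := size_neq0 s0 ts.
    by rewrite magnus_eq1_add ?ts // ls // add0r (magnus_eq1_0 eu) ?ts.
  by rewrite magnus_eq1_add // (magnus_eq1_0 eu) ?addr0.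
- have eg := magnus_eq_le (ltnW gt) es.
  exists u; split=> //; first exact: mul1.
    move=> t ts tp; have t0 := size_neq0 u0 ts.
    by rewrite magnus_eq1_add ?ts // lu // addr0 (magnus_eq1_0 es) ?ts.
  by rewrite magnus_eq1_add // (magnus_eq1_0 es) ?add0r.
- have add t : size t = size s -> magnus (g * h)%g t = magnus g t + magnus h t.
    by move=> ts; have t0 := size_neq0 s0 ts; rewrite magnus_eq1_add // ts // eq.
  have ex : magnus_eq (size s) (g * h)%g 1%g by apply: mul1; rewrite // eq.
  case: (ltngtP (choice.pickle s) (choice.pickle u)) => [lt|gt|/(pcan_inj choice.pickleK) e].
  + exists s; split=> // [t ts tp|]; last by rewrite add // lu ?addr0.
    by rewrite add // ls // lu ?addr0 ?ts // (ltn_trans tp).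
  + exists u; rewrite -eq; split=> // [t ts tp|]; last by rewrite add // ls ?add0r // eq.
    by rewrite add // lu ?ts // ls ?addr0 // (ltn_trans tp).
  + rewrite -e in lu mu; exists s; split=> // [t ts tp|]; last by rewrite add // addr_gt0.
    by rewrite add // ls // lu.
Qed.

Lemma magnus_posJ g h : magnus_pos g -> magnus_pos (g ^ h)%g.
Proof.
move=> [s [s0 es ls ms]]; exists s; split=> // [|t ts tp|].
- exact: magnus_eq1J.
- by rewrite magnus_conj ?ls ?ts //; apply: size_neq0 ts.
- by rewrite magnus_conj.
Qed.

Lemma magnus_pos_total g : [\/ g = 1%g, magnus_pos g | magnus_pos g^-1%g].
Proof.
have [->|g1] := pselect (g = 1%g); first by constructor 1.
have [s0 [s0n ms0 es0]] := magnus_depth g1.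
pose P n := `[< exists s, [/\ choice.pickle s = n, size s = size s0 & magnus g s != 0] >].
have exP : exists n, P n by exists (choice.pickle s0); apply/asboolP; exists s0.
case: (ex_minnP exP) => n /asboolP[s [sn ss ms]] min_n.
have sn0 := size_neq0 s0n ss; rewrite -ss in es0.
have ls t : size t = size s -> (choice.pickle t < choice.pickle s)%N -> magnus g t = 0.
  move=> ts; apply: contraTeq => mt; rewrite -leqNgt sn; apply: min_n.
  by apply/asboolP; exists t; rewrite ts.
have add t : size t = size s -> magnus g^-1%g t = - magnus g t.
  move=> ts; have t0 := size_neq0 sn0 ts; apply/eqP; rewrite -addr_eq0 addrC.
  rewrite -magnus_eq1_add ?ts ?mulgV ?magnus1 //; first by case: t t0 {ts}.
  exact: magnus_eq1V.
have [lt|gt] := ltrP 0 (magnus g s); first by constructor 2; exists s.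
constructor 3; exists s; split=> //; first exact: magnus_eq1V.
  by move=> t ts tp; rewrite add // ls ?oppr0.
by rewrite add // oppr_gt0 lt_neqAle ms.
Qed.

Lemma magnus_pos1 : ~ magnus_pos (1%g : F).
Proof. by case=> s [s0 _ _]; rewrite magnus1 /sone; case: s s0. Qed.

Lemma magnus_pos_cone : @cone F predT magnus_pos.
Proof.
split; [exact: magnus_pos1 | by move=> *; apply: magnus_posM | by move=> *; apply: magnus_posJ |].
by move=> g _; apply: magnus_pos_total.
Qed.
End Positive.

(** * Subgroups without characters that kill a given element *)

Lemma subgX (G : groupType) (H : pred G) x n : subgroup H -> H x -> H (x ^+ n)%g.
Proof.
move=> sH hx; elim: n => [|n IH]; first by rewrite expg0; apply: subg1.
by rewrite expgS; apply: subgM.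
Qed.

Definition hom_on (G : groupType) (H : pred G) (phi : G -> int) :=
  forall x y, H x -> H y -> phi (x * y)%g = phi x + phi y.

Lemma hom_on1 (G : groupType) (H : pred G) (phi : G -> int) :
  subgroup H -> hom_on H phi -> phi 1%g = 0.
Proof. by move=> sH hom; have := hom 1%g 1%g (subg1 sH) (subg1 sH); rewrite mulg1; lia. Qed.

Lemma hom_onV (G : groupType) (H : pred G) (phi : G -> int) x :
  subgroup H -> hom_on H phi -> H x -> phi x^-1%g = - phi x.
Proof.
move=> sH hom hx; have := hom _ _ hx (subgV sH hx).
by rewrite mulgV (hom_on1 sH hom); lia.
Qed.

Section Isolator.
Variable T : countType.
Local Notation F := (free_group T).
Implicit Types (g h w : F) (s t u : seq T) (H : pred F).

Lemma magnus_eq1X k g n : magnus_eq k g 1%g -> magnus_eq k (g ^+ n)%g 1%g.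
Proof. by move=> /(magnus_eqX n); rewrite expg1n. Qed.

Lemma magnus_eq1_zpow k g z : magnus_eq k g 1%g -> magnus_eq k (zpow g z) 1%g.
Proof. by move=> e; case: z => n; [|apply: magnus_eq1V]; apply: magnus_eq1X. Qed.

Lemma commute_magnus_root k n g h : (0 < n)%N ->
  magnus_eq k (g ^+ n * h)%g (h * g ^+ n)%g -> magnus_eq k (g * h)%g (h * g)%g.
Proof.
move=> n0 e; have rf (x : F) : magnus_eq k x x by [].
have /(magnus_eq_root n0) ek : magnus_eq k ((g ^ h) ^+ n)%g (g ^+ n)%g.
  rewrite -conjXg /conjg; have := magnus_eqM (rf h^-1%g) e.
  by rewrite mulKg.
by rewrite conjgC; apply: magnus_eqM.
Qed.

Lemma commute_magnusX k n g h : magnus_eq k (g * h)%g (h * g)%g ->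
  magnus_eq k (g * h ^+ n)%g (h ^+ n * g)%g.
Proof.
move=> e; have rf (x : F) : magnus_eq k x x by [].
elim: n => [|n IH]; first by rewrite expg0 mulg1 mul1g.
have e1 := magnus_eqM e (rf (h ^+ n)%g); have e2 := magnus_eqM (rf h) IH.
by rewrite expgS mulgA -[X in magnus_eq _ _ X]mulgA; apply: magnus_eq_trans e1 _; rewrite -mulgA.
Qed.

Lemma magnus_eqMn k n g h : magnus_eq k (g * h)%g (h * g)%g ->
  magnus_eq k ((g * h) ^+ n)%g (g ^+ n * h ^+ n)%g.
Proof.
move=> e; have rf (x : F) : magnus_eq k x x by [].
elim: n => [|n IH]; first by rewrite !expg0 mulg1.
rewrite [((g * h) ^+ _)%g]expgS; apply: magnus_eq_trans (magnus_eqM (rf _) IH) _.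
rewrite !expgS -!mulgA; apply: magnus_eqM => //; rewrite !mulgA; apply: magnus_eqM => //.
exact/commute_magnusX/magnus_eq_sym.
Qed.

(** Let d be the length of the leading word s of w. Coefficients of length less
    than d are characters of H that kill w, so they vanish and every element of
    H is trivial below d. Hence the coefficient at s is a character c,
    normalized so that c w is the positive integer M. Then g ^+ M and the power
    c g of w agree at every length: at the first length where they may differ,
    the difference of their coefficients is again a character that kills w. *)
Lemma isolator H w : subgroup H -> H w -> w <> 1%g ->
    (forall phi : F -> int, hom_on H phi -> phi w = 0 -> forall g, H g -> phi g = 0) ->
  exists2 M : nat, (0 < M)%N & forall g, H g -> exists z, (g ^+ M)%g = zpow w z.
Proof.
move=> sH Hw w1 phi0.
have [s [s0 ms es]] := magnus_depth w1; set d := size s in es.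
have stage1 k : (k <= d)%N -> forall g, H g -> magnus_eq k g 1%g.
  elim: k => [|k IH] kd g Hg // t; rewrite ltnS leq_eqVlt => /orP[/eqP tk|]; last first.
    by move=> lt; apply: IH => //; apply: ltnW.
  have [->|t0] := pselect (t = [::]); first by rewrite !magnus_nil.
  rewrite magnus1 /sone (_ : (t == [::]) = false); last by apply/eqP.
  apply: (phi0 (fun g => magnus g t)) => //.
    by move=> x y Hx Hy; rewrite magnus_eq1_add // tk; apply: IH => //; apply: ltnW.
  by rewrite (magnus_eq1_0 es) // tk.
have add g h t : H g -> H h -> size t = d -> magnus (g * h)%g t = magnus g t + magnus h t.
  move=> Hg Hh td; have t0 := size_neq0 s0 td.
  by apply: magnus_eq1_add => //; rewrite td; apply: stage1.
(* The sign makes c w the positive integer M, so that it can be an exponent. *)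
pose M := `|magnus w s|%N; pose c g := Num.sg (magnus w s) * magnus g s.
have cM g h : H g -> H h -> c (g * h)%g = c g + c h.
  by move=> Hg Hh; rewrite /c add // mulrDr.
have cw : c w = M by rewrite /c /M abszE [RHS]normrEsg.
have M0 : (0 < M)%N by rewrite absz_gt0.
exists M => // g Hg; exists (c g).
apply: magnus_eqP => k; elim: k g Hg => [|k IH] // g Hg.
have [kd|dk] := ltnP k d.
  apply: (magnus_eq_le kd); apply: magnus_eq_trans (_ : magnus_eq _ 1%g _).
    exact/magnus_eq1X/stage1.
  exact/magnus_eq_sym/magnus_eq1_zpow/stage1.
have k0 : (0 < k)%N by apply: leq_trans dk; rewrite /d; case: (s) s0.
(* The discrepancy between g ^+ M and the expected power of w; it is additive
   at length k because elements of H commute up to that length. *)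
pose kap t g := magnus (g ^+ M)%g t - magnus (zpow w (c g)) t.
have prodE t x y : size t = k -> H x -> H y ->
    magnus (x ^+ M * y ^+ M)%g t = magnus (zpow w (c x + c y)) t + kap t x + kap t y.
  move=> tk Hx Hy; have t0 : t <> [::] by case: t tk => // tk; rewrite -tk in k0.
  have := @magnus_diff T (x ^+ M)%g (zpow w (c x)) (y ^+ M)%g (zpow w (c y)) t t0.
  rewrite tk -zpowD => /(_ (IH _ Hx) (IH _ Hy)) e.
  by rewrite -addrA /kap -e; ring.
have comm x y : H x -> H y -> magnus_eq k.+1 (x * y)%g (y * x)%g.
  move=> Hx Hy.
  have e2 : magnus_eq k.+1 (x ^+ M * y ^+ M)%g (y ^+ M * x ^+ M)%g.
    move=> t; rewrite ltnS leq_eqVlt => /orP[/eqP tk|tk].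
      by rewrite !prodE // [c y + _]addrC; ring.
    rewrite (magnus_eqM (IH _ Hx) (IH _ Hy)) // (magnus_eqM (IH _ Hy) (IH _ Hx)) //.
    by rewrite -!zpowD addrC.
  apply: (commute_magnus_root M0); apply/magnus_eq_sym/(commute_magnus_root M0).
  exact/magnus_eq_sym.
move=> t; rewrite ltnS leq_eqVlt => /orP[/eqP tk|]; last exact: IH.
suff : kap t g = 0 by move/eqP; rewrite subr_eq0 => /eqP.
apply: (phi0 (kap t)) => // [x y Hx Hy|]; last by rewrite /kap cw subrr.
rewrite {1}/kap cM // (magnus_eqMn M (comm _ _ Hx Hy)) ?tk //.
by rewrite prodE //; ring.
Qed.
End Isolator.

(** * Centralizers in a free group *)

Lemma conj_zpow (G : groupType) (x y : G) z : (zpow x z ^ y)%g = zpow (x ^ y)%g z.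
Proof. by case: z => n /=; rewrite ?conjVg conjXg. Qed.

Section Centralizer.
Variable T : choiceType.
Local Notation F := (free_group T).
Implicit Types (g h : F) (a b : T * bool) (s t : seq (T * bool)).

Definition len g := size (val g).

Lemma lenV g : len g^-1%g = len g.
Proof. by rewrite /len /= /winv size_rev size_map. Qed.

Lemma len1 g : (len g == 0%N) = (g == 1%g).
Proof. by rewrite /len size_eq0 -(inj_eq val_inj). Qed.

Lemma lenM_le g h : (len (g * h)%g <= len g + len h)%N.
Proof.
rewrite /len /=; elim: (val g) => //= a s IH.
case: (wmul s (val h)) IH => [|b u] //= IH; case: eqP => _ /=; lia.
Qed.

Lemma wmul_cat s t : reduced (s ++ t) -> wmul s t = s ++ t.
Proof.
elim: s => //= a s IH r; rewrite IH ?push_cons //; exact: reduced_behead r.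
Qed.

Definition fhead g := ohead (val g).

Lemma fhead_some g : g <> 1%g -> exists a, fhead g = Some a.
Proof.
rewrite /fhead; case: g => -[|a s] rs g1; first by case: g1; apply/val_inj.
by exists a.
Qed.

Lemma fhead_split g a : fhead g = Some a -> exists2 g',
  g = (FreeGroup (isT : reduced [:: a]) * g')%g & val g = a :: val g'.
Proof.
case: g => -[|b s] rs //= [eb]; subst b; exists (FreeGroup (reduced_behead rs)) => //.
by apply/val_inj; rewrite /= push_cons.
Qed.

Lemma fheadV g a : fhead g^-1%g = Some a -> exists s, val g = rcons s (linv a).
Proof.
rewrite /fhead /= /winv; case/lastP: (val g) => // s b; rewrite map_rcons rev_rcons /=.
by case=> <-; exists s; rewrite linvK.
Qed.

Lemma val_mul_cat g h : fhead g^-1%g <> fhead h -> val (g * h)%g = val g ++ val h.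
Proof.
move=> ne; rewrite /= wmul_cat //.
have := valP g; have := valP h; move: ne; rewrite /fhead /= /winv.
case/lastP: (val g) => // s a; case: (val h) => [|b t]; first by rewrite cats0.
rewrite map_rcons rev_rcons /= => ne rt rs.
have -> : rcons s a ++ b :: t = s ++ a :: b :: t by rewrite cat_rcons.
move: rs; rewrite -cats1 /reduced; case: s => [|c s] /=.
  by rewrite rt andbT => _; apply/eqP => e; apply: ne; rewrite e.
rewrite !cat_path /= => /and3P[-> -> _] /=; rewrite rt andbT.
by apply/eqP => e; apply: ne; rewrite e.
Qed.

Lemma len_cancel g h : g <> 1%g -> fhead g^-1%g = fhead h -> (len (g * h)%g < len g + len h)%N.
Proof.
move=> g1 e; have [a ea] : exists a, fhead g^-1%g = Some a.
  by apply: fhead_some => /(canRL invgK); rewrite invg1.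
have [g' eg vg] := fhead_split ea; have [h' eh vh] := fhead_split (etrans (esym e) ea).
have -> : (g * h = g'^-1 * h')%g by rewrite -[g]invgK eg eh invgM -mulgA mulKg.
have := lenM_le g'^-1%g h'; rewrite -(lenV g) lenV /len vg vh /=; lia.
Qed.

(** Induction on the total length. If x y has no cancellation then neither has
    y x, and the shorter word is a prefix of the longer one and can be removed
    from it. If both products cancel, replace g by its inverse. If there is a
    cancellation even then, both words begin with the same letter and end with
    its inverse, and conjugation by that letter shortens them. *)
Lemma commute_cyclic g h : commute g h ->
  exists (t : F) (i j : int), g = zpow t i /\ h = zpow t j.
Proof.
have [n] := ubnP (len g + len h)%N; elim: n g h => // n IH g h ltn c.
have [->|g1] := pselect (g = 1%g); first by exists h, 0, 1.
have [->|h1] := pselect (h = 1%g); first by exists g, 1, 0.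
(* No cancellation in x * y, and x is not longer than y: x is a prefix of y. *)
have step0 x y : commute x y -> x <> 1%g -> y <> 1%g -> (len x + len y < n.+1)%N ->
    (len x <= len y)%N -> fhead x^-1%g <> fhead y ->
    exists (t : F) (i j : int), x = zpow t i /\ y = zpow t j.
  move=> cxy x1 y1 lt le ne; have exy := val_mul_cat ne.
  have eyx : val (y * x)%g = val y ++ val x.
    apply: val_mul_cat => e; have := len_cancel y1 e.
    rewrite /len -cxy exy size_cat; lia.
  have := congr1 (take (len x)) exy; rewrite cxy eyx take_cat take_size_cat //.
  have tk : take (len x) (val y ++ val x) = take (len x) (val y).
    rewrite take_cat; case: ltnP => // ge.
    have -> : len x = len y by apply/eqP; rewrite eqn_leq le.
    by rewrite subnn take0 cats0 take_size.
  rewrite -take_cat tk => ex.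
  have ry : reduced (drop (len x) (val y)).
    have := valP y; rewrite -{1}(cat_take_drop (len x) (val y)).
    by rewrite /reduced => /cat_sorted2[].
  pose y' := FreeGroup ry.
  have ey : y = (x * y')%g.
    apply/val_inj; rewrite [RHS]/= wmul_cat -ex cat_take_drop //; exact: valP y.
  have x0 : (0 < len x)%N by rewrite lt0n len1; apply/eqP.
  have ly : (len y' = len y - len x)%N by rewrite /len /= size_drop.
  have [||t [i [j [ei ej]]]] := IH x y'; first by rewrite ly; lia.
    by apply: (@mulgI _ x); rewrite -ey cxy [in LHS]ey -mulgA.
  by exists t, i, (i + j); split=> //; rewrite ey zpowD -ei -ej.
have step x y : commute x y -> x <> 1%g -> y <> 1%g -> (len x + len y < n.+1)%N ->
    fhead x^-1%g <> fhead y ->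
    exists (t : F) (i j : int), x = zpow t i /\ y = zpow t j.
  move=> cxy x1 y1 lt ne; case: (leqP (len x) (len y)) => [|/ltnW] le.
    exact: step0.
  have ne' : fhead y^-1%g <> fhead x.
    move=> e; have := len_cancel y1 e.
    by rewrite /len -cxy (val_mul_cat ne) size_cat; lia.
  have [||||||t [i [j [ei ej]]]] := step0 y x; rewrite // 1?addnC //.
  by exists t, j, i.
have [e1|ne1] := pselect (fhead g^-1%g = fhead h); last exact: step.
have [e2|ne2] := pselect (fhead h^-1%g = fhead g); last first.
  have [|||||t [i [j [ei ej]]]] := step h g; rewrite // 1?addnC //.
  by exists t, j, i.
(* When the first letters differ, replacing g by its inverse reduces to the
   case without cancellation. *)
have [e3|ne3] := pselect (fhead g = fhead h); last first.
  have [|||||t [i [j [ei ej]]]] := step g^-1%g h; rewrite ?invgK ?lenV //.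
  - exact/commute_sym/commuteV/commute_sym.
  - by move/(canRL invgK); rewrite invg1.
  by exists t, (- i), j; split=> //; rewrite zpowN -ei invgK.
have [a ea] := fhead_some g1.
(* Both words now begin with the letter a and end with its inverse. *)
pose la : F := FreeGroup (isT : reduced [:: a]).
have shrink x : fhead x = Some a -> fhead x^-1%g = Some a -> (len (x ^ la)%g < len x)%N.
  move=> hx hVx; have [x' ex vx] := fhead_split hx.
  have -> : (x ^ la = x' * la)%g by rewrite /conjg ex -mulgA mulKg.
  have [s es] := fheadV hVx; move: es; rewrite vx /len vx.
  case/lastP vx': (val x') => [|u b].
    by case: s => [|? []] // [] /(congr1 snd) /=; case: (a.2).
  rewrite -rcons_cons => /rcons_inj[_ eb].
  have /len_cancel : x' <> 1%g by move=> e; move: vx'; rewrite e; case: (u).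
  move/(_ la); rewrite /fhead /= /winv /len /= vx' map_rcons rev_rcons /= eb linvK.
  by move/(_ erefl); rewrite !size_rcons; lia.
have [||t [i [j [ei ej]]]] := IH (g ^ la)%g (h ^ la)%g.
- have := shrink g ea; have := shrink h; rewrite e2 e1 -e3 ea => /(_ erefl erefl) + /(_ erefl).
  lia.
- by rewrite /commute -!conjMg c.
by exists (t ^ la^-1)%g, i, j; rewrite -!conj_zpow -ei -ej !conjgK.
Qed.

End Centralizer.

Section Roots.
Variable T : countType.
Local Notation F := (free_group T).
Implicit Types (g h w : F).

Lemma magnus_zpow w s z : s <> [::] -> magnus_eq (size s) w 1%g ->
  magnus (zpow w z) s = z * magnus w s.
Proof.
move=> s0 e.
have nat_case n : magnus (w ^+ n)%g s = n%:Z * magnus w s.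
  have := magnus_diffX n s0 e; rewrite expg1n magnus1 /sone.
  by rewrite (_ : (s == [::]) = false) ?subr0 //; apply/eqP.
case: z => n /=; first exact: nat_case.
have e1 : magnus_eq (size s) (w ^+ n.+1)%g 1%g by apply: magnus_eq1X.
have := magnus_eq1_add s0 e1 (magnus_eq1V e1); rewrite mulgV magnus1 nat_case /sone.
rewrite (_ : (s == [::]) = false) /=; last by apply/eqP.
by rewrite NegzE mulNr => /esym/eqP; rewrite addrC addr_eq0 => /eqP.
Qed.

Lemma non_power_centralizer w g : w <> 1%g -> non_power w -> commute g w ->
  exists z, g = zpow w z.
Proof.
move=> w1 np c; have [t [i [j [eg ew]]]] := commute_cyclic c.
suff [j1|j1] : j = 1 \/ j = - 1.
- by exists i; rewrite ew j1 -zpowM mul1r.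
- by exists (- i); rewrite ew j1 -zpowM mulN1r opprK.
case: j ew => n ew; first (left; congr Posz); last (right; rewrite NegzE; congr (- Posz _)).
  by case: n ew => [|[|n]] // ew; case: (np t n.+2).
case: n ew => [|n] // ew; case: (np t^-1%g n.+2) => //.
by rewrite ew /= -expVgn.
Qed.

(** Conjugation preserves the leading coefficient and powers multiply it by the
    exponent. So a power of w can be conjugate only to the same power of w, and
    then h commutes with it, hence with w. *)
Lemma non_power_malnormal w h k z : w <> 1%g -> non_power w -> (0 < k)%N ->
  (w ^+ k ^ h)%g = zpow w z -> exists z', h = zpow w z'.
Proof.
move=> w1 np k0 e; have [s [s0 ms es]] := magnus_depth w1.
have ez : z = k.
  have := magnus_conj h s0 (magnus_eq1X k es); rewrite e -zpowX !magnus_zpow //.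
  by move/(mulIf ms).
apply: non_power_centralizer => //; apply: commute_sym.
apply: (fg_commute_root k0).
by rewrite /commute conjgC e ez.
Qed.
End Roots.

(** * Coefficients and supports in a group algebra *)

Section Coef.
Variables (K : fieldType) (G : groupType).
Local Notation A := (group_algebra K G).
Implicit Types (a b : A) (g h x y z : G) (c : K) (S : pred G).

(** Coefficients and supports are restated for group_algebra, whose elements
    are elements of a malg type but whose product is the one of the group. *)
Definition co g a : K := mcoeff g a.
Definition supp a : {fset G} := msupp a.

Lemma coP a b : (forall g, co g a = co g b) -> a = b.
Proof. by move=> e; apply/malgP. Qed.
Lemma suppE a g : (g \in supp a) = (co g a != 0).
Proof. by rewrite /co mcoeff_neq0. Qed.
Lemma co0 g : co g 0 = 0. Proof. exact: mcoeff0. Qed.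
Lemma coD g a b : co g (a + b) = co g a + co g b. Proof. exact: mcoeffD. Qed.
Lemma coN g a : co g (- a) = - co g a. Proof. exact: mcoeffN. Qed.
Lemma coB g a b : co g (a - b) = co g a - co g b. Proof. exact: mcoeffB. Qed.
Lemma coZ g c a : co g (c *: a) = c * co g a. Proof. exact: mcoeffZ. Qed.
Lemma co_sum I (r : seq I) (P : pred I) (f : I -> A) g :
  co g (\sum_(i <- r | P i) f i) = \sum_(i <- r | P i) co g (f i).
Proof. exact: (big_morph (co g) (fun a b => coD g a b) (co0 g)). Qed.
Lemma co_of g h : co g (ga_of K h) = (h == g)%:R.
Proof. by rewrite /co /ga_of mcoeffU. Qed.
Lemma co1 g : co g (1 : A) = (1%g == g)%:R.
Proof. exact: co_of. Qed.
Lemma coU g h c : co g (mkmalgU h c : A) = c *+ (h == g).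
Proof. by rewrite /co mcoeffU. Qed.

Lemma coMw (d : {fset G}) a b z : {subset supp a <= d} ->
  co z (a * b) = \sum_(x <- d) co x a * co (x^-1 * z)%g b.
Proof.
move=> sd; rewrite [a * b](_ : _ = ga_mul a b) //.
have le_d : (msupp a `<=` d)%fset by apply/fsubsetP.
rewrite (ga_mulwl le_d (fsubset_refl (msupp b))) co_sum.
apply: eq_bigr => x _; rewrite co_sum.
under eq_bigr => h _ do rewrite coU.
have [inb|nb] := boolP ((x^-1 * z)%g \in msupp b); last first.
  rewrite [X in _ * X](mcoeff_outdom nb) mulr0 big1_seq // => h /andP[_ hb].
  case: eqP => // e; case/negP: nb; by rewrite -e mulKg.
rewrite (big_fsetD1 _ inb) /= mulVKg eqxx mulr1n big1_seq ?addr0 // => h /andP[_].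
rewrite in_fsetD1 => /andP[ne _]; case: eqP => // e; case/negP: ne.
by rewrite -e mulKg.
Qed.

Lemma coM a b z : co z (a * b) = \sum_(x <- supp a) co x a * co (x^-1 * z)%g b.
Proof. exact: coMw. Qed.

Lemma coMrw (d : {fset G}) a b z : {subset supp b <= d} ->
  co z (a * b) = \sum_(y <- d) co (z * y^-1)%g a * co y b.
Proof.
move=> sd; rewrite [a * b](_ : _ = ga_mul a b) //.
have le_d : (msupp b `<=` d)%fset by apply/fsubsetP.
rewrite (ga_mulwl (fsubset_refl (msupp a)) le_d) exchange_big /= co_sum.
apply: eq_bigr => y _; rewrite co_sum.
under eq_bigr => h _ do rewrite coU.
have [ina|na] := boolP ((z * y^-1)%g \in msupp a); last first.
  rewrite [X in X * _](mcoeff_outdom na) mul0r big1_seq // => h /andP[_ hb].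
  case: eqP => // e; case/negP: na; by rewrite -e mulgK.
rewrite (big_fsetD1 _ ina) /= mulgVK eqxx mulr1n big1_seq ?addr0 // => h /andP[_].
rewrite in_fsetD1 => /andP[ne _]; case: eqP => // e; case/negP: ne.
by rewrite -e mulgK.
Qed.

Lemma co_Mr a y z : co z (a * ga_of K y) = co (z * y^-1)%g a.
Proof.
rewrite (@coMrw [fset y]%fset) => [|x]; first by rewrite big_seq_fset1 co_of eqxx mulr1.
by rewrite suppE co_of inE; case: (y =P x) => [->|_]; rewrite ?mulr0n eqxx.
Qed.

Lemma suppM a b z : z \in supp (a * b) ->
  exists x y, [/\ x \in supp a, y \in supp b & z = (x * y)%g].
Proof.
rewrite suppE coM => nz.
have [x xa] : exists2 x, x \in supp a & co x a * co (x^-1 * z)%g b != 0.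
  apply: contrapT => no; case/eqP: nz; rewrite big1_seq // => x /andP[_ xa].
  by apply/eqP; apply: contrapT => /negP h; apply: no; exists x.
rewrite mulf_eq0 negb_or => /andP[_ yb]; exists x, (x^-1 * z)%g; split=> //.
  by rewrite suppE.
by rewrite mulVKg.
Qed.

Definition res S a : A := \sum_(g <- supp a | S g) mkmalgU g (co g a).

Lemma co_res S a g : co g (res S a) = if S g then co g a else 0.
Proof.
rewrite /res co_sum.
have [ga|ga] := boolP (g \in supp a); last first.
  have e : co g a = 0 by apply/eqP; move: ga; rewrite suppE negbK.
  rewrite e if_same big1_seq // => h /andP[_ hs]; rewrite coU.
  by case: eqP hs ga => // ->  ->.
case: ifP => Sg.
  rewrite big_mkcond /= (big_fsetD1 _ ga) /= Sg coU eqxx mulr1n big1_seq ?addr0 // => h /andP[_].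
  by rewrite in_fsetD1 => /andP[ne _]; case: ifP => _; rewrite ?co0 // coU (negbTE ne).
rewrite big1_seq // => h /andP[Sh _]; rewrite coU; case: eqP => // e.
by rewrite -e Sh in Sg.
Qed.

Lemma supp_res S a g : (g \in supp (res S a)) = S g && (g \in supp a).
Proof. by rewrite !suppE co_res; case: (S g); rewrite ?eqxx. Qed.

Lemma resM S S1 S2 a b :
    (forall x y, x \in supp a -> y \in supp b -> S (x * y)%g = S1 x && S2 y) ->
  res S (a * b) = res S1 a * res S2 b.
Proof.
move=> hS; apply: coP => z; rewrite co_res coM (@coMw (supp a)); last first.
  by move=> x; rewrite supp_res => /andP[].
case: ifP => Sz.
  apply: eq_big_seq => x xa; rewrite !co_res.
  have [e|ne] := eqVneq (co (x^-1 * z)%g b) 0; first by rewrite e if_same !mulr0.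
  have yb : (x^-1 * z)%g \in supp b by rewrite suppE.
  have : S (x * (x^-1 * z))%g by rewrite mulVKg.
  by rewrite hS // => /andP[-> ->].
apply/esym/big1_seq => x /andP[_ xa]; rewrite !co_res.
have [e|ne] := eqVneq (co (x^-1 * z)%g b) 0; first by rewrite e if_same mulr0.
have yb : (x^-1 * z)%g \in supp b by rewrite suppE.
have : ~~ S (x * (x^-1 * z))%g by rewrite mulVKg Sz.
by rewrite hS // negb_and => /orP[]/negbTE->; rewrite ?mul0r ?mulr0.
Qed.

Lemma resD S a b : res S (a + b) = res S a + res S b.
Proof. by apply: coP => g; rewrite !(co_res, coD); case: ifP; rewrite ?addr0. Qed.
Lemma res_id S a : (forall g, g \in supp a -> S g) -> res S a = a.
Proof.
move=> h; apply: coP => g; rewrite co_res; case: ifP => // Sg.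
have [/h|] := boolP (g \in supp a); first by rewrite Sg.
by rewrite suppE negbK => /eqP.
Qed.

Lemma resMl S S1 a b :
    (forall x y, x \in supp a -> y \in supp b -> S (x * y)%g = S1 x) ->
  res S (a * b) = res S1 a * b.
Proof.
move=> h; rewrite (@resM S S1 predT a b) => [|x y xa yb]; last by rewrite andbT; exact: h.
by rewrite (@res_id predT b).
Qed.
Lemma resMr S S2 a b :
    (forall x y, x \in supp a -> y \in supp b -> S (x * y)%g = S2 y) ->
  res S (a * b) = a * res S2 b.
Proof.
move=> h; rewrite (@resM S predT S2 a b) => [|x y xa yb]; last exact: h.
by rewrite (@res_id predT a).
Qed.

Section Lift.
Variables (R : algType K) (rho : G -> R).
Hypothesis rhoM : forall x y, rho (x * y)%g = rho x * rho y.

Definition ga_lift a : R := \sum_(g <- supp a) co g a *: rho g.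

Lemma ga_liftw (d : {fset G}) a : {subset supp a <= d} ->
  ga_lift a = \sum_(g <- d) co g a *: rho g.
Proof.
move=> sd; rewrite /ga_lift; apply: big_fset_incl; first exact/fsubsetP.
by move=> g _ /mcoeff_outdom e; rewrite /co e scale0r.
Qed.

Lemma ga_liftD a b : ga_lift (a + b) = ga_lift a + ga_lift b.
Proof.
rewrite (@ga_liftw (supp a `|` supp b)%fset); last exact/fsubsetP/msuppD_le.
rewrite (@ga_liftw (supp a `|` supp b)%fset a); last exact/fsubsetP/fsubsetUl.
rewrite (@ga_liftw (supp a `|` supp b)%fset b); last exact/fsubsetP/fsubsetUr.
by rewrite -big_split /=; apply: eq_bigr => g _; rewrite coD scalerDl.
Qed.

Lemma ga_lift0 : ga_lift 0 = 0.
Proof. by rewrite /ga_lift big1 // => g _; rewrite co0 scale0r. Qed.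

Lemma ga_lift_sum I (r : seq I) (P : pred I) (f : I -> A) :
  ga_lift (\sum_(i <- r | P i) f i) = \sum_(i <- r | P i) ga_lift (f i).
Proof. exact: (big_morph ga_lift ga_liftD ga_lift0). Qed.

Lemma ga_liftU g c : ga_lift (mkmalgU g c : A) = c *: rho g.
Proof.
rewrite (@ga_liftw [fset g]%fset); last exact/fsubsetP/msuppU_le.
by rewrite big_seq_fset1 coU eqxx.
Qed.

Lemma ga_lift_of g : ga_lift (ga_of K g) = rho g.
Proof. by rewrite ga_liftU scale1r. Qed.

Lemma ga_liftZ c a : ga_lift (c *: a) = c *: ga_lift a.
Proof.
rewrite (@ga_liftw (supp a)); last exact/fsubsetP/msuppZ_le.
by rewrite /ga_lift scaler_sumr; apply: eq_bigr => g _; rewrite coZ scalerA.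
Qed.

Lemma ga_liftM a b : ga_lift (a * b) = ga_lift a * ga_lift b.
Proof.
rewrite [a * b](_ : _ = ga_mul a b) // /ga_mul ga_lift_sum mulr_suml.
apply: eq_bigr => x _; rewrite ga_lift_sum mulr_sumr; apply: eq_bigr => y _.
by rewrite ga_liftU rhoM -scalerAl -scalerAr scalerA.
Qed.
End Lift.
End Coef.

(** * Finite trees of words *)

Section Trees.
Variable T : choiceType.
Local Notation F := (free_group T).

(** A finite subtree of the Cayley graph that contains 1, with m edges, each
    oriented along its generator, and m.+1 vertices. Only connectedness is
    recorded, as an induction principle along the edges; the numbers of
    vertices and edges make the graph a tree. *)
Record tree m := Tree {
  src : 'I_m -> 'I_m.+1; tgt : 'I_m -> 'I_m.+1; lab : 'I_m -> T;
  vtx : 'I_m.+1 -> F;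
  vtx0 : vtx ord0 = 1%g;
  vtxE : forall j, vtx (tgt j) = (vtx (src j) * fg_gen (lab j))%g;
  conn : forall Q : 'I_m.+1 -> Prop,
    Q ord0 -> (forall j, Q (src j) <-> Q (tgt j)) -> forall i, Q i }.

Definition fg_letter (l : T * bool) : F := FreeGroup (isT : reduced [:: l]).

Lemma fg_letterE x b : fg_letter (x, b) = if b then (fg_gen x)^-1%g else fg_gen x.
Proof. by case: b; apply/val_inj. Qed.

Lemma tree_add m (t : tree m) i0 (l : T * bool) : exists t' : tree m.+1,
  (forall i, exists i', vtx t' i' = vtx t i) /\
  exists i', vtx t' i' = (vtx t i0 * fg_letter l)%g.
Proof.
case: l => x b.
pose up (i : 'I_m.+1) : 'I_m.+2 := lift ord_max i.
pose vt (i : 'I_m.+2) := if unlift ord_max i is Some i' then vtx t i'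
  else (vtx t i0 * fg_letter (x, b))%g.
have vtup i : vt (up i) = vtx t i by rewrite /vt /up liftK.
have vtm : vt ord_max = (vtx t i0 * fg_letter (x, b))%g by rewrite /vt unlift_none.
pose sr (j : 'I_m.+1) := if unlift ord_max j is Some j' then up (src t j')
  else if b then ord_max else up i0.
pose tg (j : 'I_m.+1) := if unlift ord_max j is Some j' then up (tgt t j')
  else if b then up i0 else ord_max.
pose la (j : 'I_m.+1) := if unlift ord_max j is Some j' then lab t j' else x.
have up0 : up ord0 = ord0 by apply: val_inj.
have v0 : vt ord0 = 1%g by rewrite -up0 vtup vtx0.
have vE j : vt (tg j) = (vt (sr j) * fg_gen (la j))%g.
  rewrite /tg /sr /la; case: unliftP => [j' _|_]; first by rewrite !vtup vtxE.
  by case: (b) vtm => vtm; rewrite vtup vtm fg_letterE ?mulgVK.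
have cn Q : Q ord0 -> (forall j, Q (sr j) <-> Q (tg j)) -> forall i, Q i.
  move=> Q0 Qe; have Qup i : Q (up i).
    apply: (conn (t := t) (Q := fun i => Q (up i))); first by rewrite up0.
    by move=> j; have := Qe (lift ord_max j); rewrite /sr /tg !liftK.
  move=> i; case: (unliftP ord_max i) => [i' ->|->]; first exact: Qup.
  have := Qe ord_max; rewrite /sr /tg !unlift_none; case: (b) => -[h1 h2].
    by apply: h2; apply: Qup.
  by apply: h1; apply: Qup.
exists (Tree v0 vE cn); split=> [i|]; first by exists (up i); rewrite /= vtup.
by exists ord_max.
Qed.

(** Each element is reached by adding the letters of its reduced word one at a
    time. *)
Lemma tree_cover (l : seq F) :
  exists m (t : tree m), forall g, g \in l -> exists i, vtx t i = g.
Proof.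
elim: l => [|g l [m [t IH]]].
  have sr (j : 'I_0) : 'I_1 by case: j.
  have la (j : 'I_0) : T by case: j.
  have vE (j : 'I_0) : (fun=> 1%g : F) (sr j) = ((fun=> 1%g) (sr j) * fg_gen (la j))%g by case: j.
  have cn (Q : 'I_1 -> Prop) : Q ord0 -> (forall j, Q (sr j) <-> Q (sr j)) -> forall i, Q i.
    by move=> Q0 _ i; rewrite ord1.
  by exists 0%N, (Tree (erefl : (fun=> 1%g : F) ord0 = 1%g) vE cn).
suff [m' [t' [ext [i ei]]]] : exists m' (t' : tree m'),
    (forall i, exists i', vtx t' i' = vtx t i) /\ exists i', vtx t' i' = g.
  exists m', t' => h; rewrite inE => /orP[/eqP->|/IH[i' <-]]; first by exists i.
  exact: ext.
have [n] := ubnP (len g); elim: n g => // n IHn g lt.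
have [->|g1] := pselect (g = 1%g).
  by exists m, t; split=> [i|]; [exists i | exists ord0; rewrite vtx0].
have [a ea] : exists a, fhead g^-1%g = Some a.
  by apply: fhead_some => /(canRL invgK); rewrite invg1.
have [h eg vg] := fhead_split ea.
have lh : (len h < n)%N by move: lt; rewrite -(lenV g) /len vg /=.
have [m' [t' [ext [i ei]]]] := IHn h^-1%g ltac:(rewrite lenV //).
have [t'' [ext' [i' ei']]] := tree_add t' i (linv a).
exists m'.+1, t''; split=> [k|].
  by have [k' <-] := ext k; apply: ext'.
exists i'; rewrite ei' ei -[g]invgK eg invgM; congr (_ * _)%g.
by apply/val_inj.
Qed.
End Trees.

(** A family of invertible elements of a ring extends to a multiplicative map
    on the free group. *)
Section WordFold.
Variables (T : choiceType) (R : pzRingType) (Y : T * bool -> R).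
Hypothesis YK : forall l, Y l * Y (linv l) = 1.

Definition wfold (v : seq (T * bool)) := foldr (fun l M => Y l * M) 1 v.

Lemma wfold_push l v : wfold (push l v) = Y l * wfold v.
Proof. by case: v => //= l' v; case: eqP => //= ->; rewrite mulrA YK mul1r. Qed.

Lemma wfoldM (g h : free_group T) :
  wfold (val (g * h)%g) = wfold (val g) * wfold (val h).
Proof.
rewrite /=; elim: (val g) => [|l v IH] /=; first by rewrite mul1r.
by rewrite wfold_push IH mulrA.
Qed.
End WordFold.

(** * Completion of unimodular rows of length two *)

Section Eval.
Variables (K : fieldType) (n : nat) (W : lmodType K) (s : 'I_n -> W).
Definition lincomb (u : 'rV[K]_n) : W := \sum_i u 0 i *: s i.
Lemma lincombD u v : lincomb (u + v) = lincomb u + lincomb v.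
Proof. by rewrite /lincomb -big_split; apply: eq_bigr => i _; rewrite mxE scalerDl. Qed.
Lemma lincombZ c u : lincomb (c *: u) = c *: lincomb u.
Proof. by rewrite /lincomb scaler_sumr; apply: eq_bigr => i _; rewrite mxE scalerA. Qed.
Lemma lincomb0 : lincomb 0 = 0.
Proof. by rewrite /lincomb big1 // => i _; rewrite mxE scale0r. Qed.
Lemma lincomb_sum I (r : seq I) (f : I -> 'rV_n) :
  lincomb (\sum_(i <- r) f i) = \sum_(i <- r) lincomb (f i).
Proof. exact: (big_morph lincomb lincombD lincomb0). Qed.
Lemma lincomb_mul m (l : 'rV_m) (M : 'M_(m, n)) : lincomb (l *m M) = \sum_j l 0 j *: lincomb (row j M).
Proof. by rewrite mulmx_sum_row lincomb_sum; apply: eq_bigr => j _; rewrite lincombZ. Qed.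
Lemma lincomb_delta i : lincomb (delta_mx 0 i) = s i.
Proof.
rewrite /lincomb (bigD1 i) //= mxE !eqxx scale1r big1 ?addr0 // => j /negbTE ne.
by rewrite mxE ne andbF scale0r.
Qed.
End Eval.

(** A partial isomorphism between subspaces of a finite-dimensional space
    extends to an automorphism. *)
Lemma same_ker_unit (K : fieldType) (m n : nat) (A B : 'M[K]_(m, n)) :
    (forall l : 'rV_m, l *m A = 0 <-> l *m B = 0) ->
  exists2 X : 'M_n, X \in unitmx & A *m X = B.
Proof.
move=> h; pose f := pinvmx A *m B.
have kill (k : nat) (L : 'M_(k, m)) (C D : 'M[K]_(m, n)) :
   (forall l : 'rV_m, l *m C = 0 -> l *m D = 0) -> L *m C = 0 -> L *m D = 0.
  move=> hCD e; apply/row_matrixP => i; rewrite row_mul row0 hCD //.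
  by rewrite -row_mul e row0.
have Af : A *m f = B.
  apply/eqP; rewrite -subr_eq0 /f mulmxA -{2}[B]mul1mx -mulmxBl.
  apply/eqP/(kill _ _ A) => [l /h//|].
  by rewrite mulmxBl mul1mx mulmxKpV ?subrr.
have rk : \rank (A *m f) = \rank A.
  rewrite Af; have eqk : (kermx A :=: kermx B)%MS.
    by apply/eqmxP/andP; split; apply/sub_kermxP;
      [apply: (kill _ _ A) | apply: (kill _ _ B)]; rewrite ?mulmx_ker // => l /h.
  have := mxrank_ker A; have := mxrank_ker B; rewrite eqk => -> .
  have := rank_leq_row A; have := rank_leq_row B; lia.
have [X uX eX] := complete_unitmx rk.
by exists X; rewrite // -eX.
Qed.

Section Unimodular.
Variables (K : fieldType) (T : choiceType) (m : nat) (t : tree T m).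
Local Notation F := (free_group T).
Local Notation A := (group_algebra K F).
Local Notation n := m.+1.

Definition vec : 'rV[K]_n -> A := lincomb (fun i => ga_of K (vtx t i) : A).

(** Row j of this matrix is the source of the edge j as a basis vector; a
    combination of edges is a row vector l, and l *m src_mx and l *m tgt_mx are
    its two ends. *)
Definition src_mx : 'M[K]_(m, n) := \matrix_(j, i) (i == src t j)%:R.
Definition tgt_mx : 'M[K]_(m, n) := \matrix_(j, i) (i == tgt t j)%:R.
Definition label_mx x : 'M[K]_m := diag_mx (\row_j (lab t j == x)%:R).

(** Only the edges with label x occur in l. *)
Definition one_label x (l : 'rV[K]_m) := l *m label_mx x = l.

Lemma row_src j : row j src_mx = delta_mx 0 (src t j).
Proof. by apply/rowP => i; rewrite !mxE eqxx. Qed.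
Lemma row_tgt j : row j tgt_mx = delta_mx 0 (tgt t j).
Proof. by apply/rowP => i; rewrite !mxE eqxx. Qed.

Lemma label_mx_idem x : label_mx x *m label_mx x = label_mx x.
Proof.
rewrite /label_mx mulmx_diag; congr diag_mx; apply/rowP => j; rewrite !mxE.
by case: eqP; rewrite ?mulr1 ?mulr0.
Qed.

Lemma one_label_delta j : one_label (lab t j) (delta_mx 0 j).
Proof.
rewrite /one_label /label_mx -rowE; apply/rowP => k; rewrite !mxE !eqxx /= [k == j]eq_sym.
by case: (j == k).
Qed.

Definition closed_under (N : 'M[K]_n) := forall x l, one_label x l ->
  (l *m src_mx <= N)%MS = (l *m tgt_mx <= N)%MS.

(** Let N be closed. On the quotient K^n / N, which is realized inside K^n by
    the columns of C, moving along the edges labelled x is then a partial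
    isomorphism, so it extends to an invertible matrix X x. These matrices
    define a representation of the free group in which g moves the root r0 to
    the vertex g. The elements a and b kill r0 because their vectors are in N,
    so 1 kills r0, and every vertex is 0 in the quotient. *)
Lemma closed_full N va vb p q :
    closed_under N -> (va <= N)%MS -> (vb <= N)%MS ->
    vec va * p + vec vb * q = 1 ->
  row_full N.
Proof.
move=> cN Na Nb e1.
(* The kernel of right multiplication by C is N, so the rows of C stand for the
   vertices in the quotient. *)
have [C NC] : exists C : 'M_n, forall k (u : 'M_(k, n)), (u *m C == 0) = (u <= N)%MS.
  by exists (cokermx N) => k u; rewrite submxE.
have XP x : exists2 X : 'M_n, X \in unitmx & label_mx x *m src_mx *m C *m X = label_mx x *m tgt_mx *m C.
  apply: same_ker_unit => l; rewrite !mulmxA.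
  have hl : one_label x (l *m label_mx x) by rewrite /one_label -mulmxA label_mx_idem.
  by split=> /eqP; rewrite NC => h; apply/eqP; rewrite NC; move: h; rewrite (cN _ _ hl).
pose X x : 'M[K]_n := s2val (cid2 (XP x)).
have uX x : X x \in unitmx by rewrite /X; case: cid2.
have eX x : label_mx x *m src_mx *m C *m X x = label_mx x *m tgt_mx *m C by rewrite /X; case: cid2.
pose Y (l : T * bool) : 'M[K]_n := if l.2 then invmx (X l.1) else X l.1.
have YK l : Y l * Y (linv l) = 1.
  rewrite /Y /=; case: l.2 => /=; first exact: mulVmx.
  exact: mulmxV.
pose rho (g : F) := wfold Y (val g).
have rhoM g h : rho (g * h)%g = rho g * rho h by apply: wfoldM.
(* The root of the tree in the quotient. *)
pose r0 : 'rV_n := row ord0 C.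
have rhov i : r0 *m rho (vtx t i) = row i C.
  apply: (conn (t := t) (Q := fun i => r0 *m rho (vtx t i) = row i C)).
    by rewrite vtx0 [rho _](_ : _ = 1%:M) // mulmx1.
  move=> j; rewrite vtxE rhoM.
  have -> : rho (fg_gen (lab t j)) = X (lab t j) by rewrite /rho /= mulr1.
  have ej : row (src t j) C *m X (lab t j) = row (tgt t j) C.
    have := congr1 (mulmx (delta_mx (0 : 'I_1) j)) (eX (lab t j)).
    by rewrite !mulmxA (one_label_delta j) -!rowE row_src row_tgt -!rowE.
  rewrite mulmxA; split=> [->|e]; first by rewrite ej.
  by rewrite -[LHS](mulmxK (uX (lab t j))) e -ej mulmxK.
pose rl := @ga_lift K F 'M[K]_n rho.
have rlvec u : r0 *m rl (vec u) = u *m C.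
  rewrite /vec /lincomb /rl ga_lift_sum mulmx_sumr mulmx_sum_row.
  by apply: eq_bigr => i _; rewrite ga_liftZ ga_lift_of -scalemxAr rhov.
have rlM x y : rl (x * y) = rl x *m rl y by apply: ga_liftM.
have rlD x y : rl (x + y) = rl x + rl y by apply: ga_liftD.
have rl1 : rl 1 = 1%:M by rewrite /rl -ga_of1 ga_lift_of.
have vk v : (v <= N)%MS -> v *m C = 0 by rewrite -NC => /eqP.
have e2 : 1%:M = rl (vec va) *m rl p + rl (vec vb) *m rl q.
  exact: etrans (esym rl1) (etrans (congr1 rl (esym e1))
    (etrans (rlD _ _) (congr2 +%R (rlM _ _) (rlM _ _)))).
have k0 v (x : 'M_n) : (v <= N)%MS -> r0 *m (rl (vec v) *m x) = 0.
  by move=> vN; rewrite mulmxA rlvec vk // mul0mx.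
have r00 : r0 = 0.
  by rewrite -[r0]mulmx1 e2 mulmxDr !k0 // addr0.
have C0 : C = 0 by apply/row_matrixP => i; rewrite -rhov r00 mul0mx row0.
by rewrite -sub1mx -NC C0 mulmx0.
Qed.
End Unimodular.

(** The group algebra enters only through its algebra structure and the
    multiplicative map io from the group. *)
Section Completion.
Variables (K : fieldType) (T : choiceType) (m : nat) (t : tree T m).
Local Notation F := (free_group T).
Local Notation n := m.+1.
Variables (A : algType K) (io : F -> A).
Hypotheses (io1 : io 1%g = 1) (ioM : forall g h, io (g * h)%g = io g * io h).
Local Notation V := (A * A)%type.
Definition avec : 'rV[K]_n -> A := lincomb (fun i => io (vtx t i)).
Variables (va vb : 'rV[K]_n).
Local Notation a := (avec va).
Local Notation b := (avec vb).
Implicit Types (s : 'I_n -> V) (l : 'rV[K]_m) (x : T) (u : 'rV[K]_n) (v : V).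

(** Pairs are columns over A, with right scalar multiplication. *)
Definition ract (x : A) v : V := (v.1 * x, v.2 * x).

(** The product of the row (a, b) with a column. *)
Definition row_app v : A := a * v.1 + b * v.2.

Lemma ractD (x : A) v v' : ract x (v + v') = ract x v + ract x v'.
Proof. by rewrite /ract /= !mulrDl. Qed.
Lemma ractZ (x : A) c v : ract x (c *: v) = c *: ract x v.
Proof. by rewrite /ract /= -!scalerAl. Qed.
Lemma ract0 (x : A) : ract x 0 = 0. Proof. by rewrite /ract /= !mul0r. Qed.
Lemma ract_sum (x : A) I (r : seq I) (f : I -> V) :
  ract x (\sum_(i <- r) f i) = \sum_(i <- r) ract x (f i).
Proof. exact: (big_morph (ract x) (ractD x) (ract0 x)). Qed.
Lemma ractM (x y : A) v : ract y (ract x v) = ract (x * y) v.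
Proof. by rewrite /ract /= !mulrA. Qed.
Lemma ractN (x : A) v : ract x (- v) = - ract x v.
Proof. by rewrite /ract /= !mulNr. Qed.
Lemma ractDr (x y : A) v : ract (x + y) v = ract x v + ract y v.
Proof. by rewrite /ract /= !mulrDr. Qed.
Lemma ractNr (x : A) v : ract (- x) v = - ract x v.
Proof. by rewrite /ract /= !mulrN. Qed.
Lemma ractZr c (x : A) v : ract (c *: x) v = c *: ract x v.
Proof. by rewrite /ract /= -!scalerAr. Qed.
Lemma ract1 v : ract 1 v = v.
Proof. by case: v => x y; rewrite /ract /= !mulr1. Qed.

Lemma row_appD v v' : row_app (v + v') = row_app v + row_app v'.
Proof. by rewrite /row_app /= (mulrDr a) (mulrDr b) [LHS]addrACA. Qed.
Lemma row_appZ c v : row_app (c *: v) = c *: row_app v.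
Proof. by rewrite /row_app /= -!scalerAr -scalerDr. Qed.
Lemma row_app_ract (x : A) v : row_app (ract x v) = row_app v * x.
Proof. by rewrite /row_app /= mulrDl (mulrA a) (mulrA b). Qed.

Definition gen x : A := io (fg_gen x).
Definition geni x : A := io (fg_gen x)^-1%g.
Lemma genK x : gen x * geni x = 1.
Proof. by rewrite /gen /geni -ioM mulgV. Qed.
Lemma geniK x : geni x * gen x = 1.
Proof. by rewrite /gen /geni -ioM mulVg. Qed.

(** The failure of s to be compatible with right multiplication along a
    combination of edges. *)
Definition edge s l : V :=
  \sum_j l 0 j *: (ract (gen (lab t j)) (s (src t j)) - s (tgt t j)).

Lemma one_labelP x l j : one_label t x l -> l 0 j != 0 -> lab t j = x.
Proof.
by move=> <-; rewrite mul_mx_diag !mxE; case: (lab t j =P x) => // _; rewrite mulr0 eqxx.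
Qed.

Lemma edge_one_label s x l : one_label t x l ->
  edge s l = ract (gen x) (lincomb s (l *m src_mx K t)) - lincomb s (l *m tgt_mx K t).
Proof.
move=> hl; rewrite !lincomb_mul ract_sum /edge -sumrB; apply: eq_bigr => j _.
rewrite row_src row_tgt !lincomb_delta ractZ -scalerBr.
have [->|lj] := eqVneq (l 0 j) 0; first by rewrite !scale0r.
by rewrite (one_labelP hl lj).
Qed.

Lemma vec_one_label x l : one_label t x l -> avec (l *m tgt_mx K t) = avec (l *m src_mx K t) * gen x.
Proof.
move=> hl; rewrite /avec !lincomb_mul mulr_suml; apply: eq_bigr => j _.
rewrite row_src row_tgt !lincomb_delta.
have [->|lj] := eqVneq (l 0 j) 0; first by rewrite !scale0r mul0r.
by rewrite vtxE ioM (one_labelP hl lj) scalerAl.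
Qed.

(** A stage in the construction of a section of the row (a, b). The map lincomb
    s sends combinations of vertices to columns; on N it is a right inverse of
    the row, and it sends the vectors of a and b to the standard basis. The
    rows of L are independent combinations of edges with a common label along
    which s is compatible with right multiplication. The bound on the rank of N
    says that each dimension of N beyond the span of a and b has been paid for
    by a row of L. *)
Record partial_section k (N : 'M[K]_n) s (L : 'M[K]_(k, m)) : Prop := PartialSection {
  ps_a : (va <= N)%MS; ps_b : (vb <= N)%MS;
  ps_sa : lincomb s va = (1, 0); ps_sb : lincomb s vb = (0, 1);
  ps_row_app : forall u, (u <= N)%MS -> row_app (lincomb s u) = avec u;
  ps_free : row_free L;
  ps_rank : (\rank N <= k.+2)%N;
  ps_row : forall i, exists x, [/\ one_label t x (row i L),
    (row i L *m src_mx K t <= N)%MS, (row i L *m tgt_mx K t <= N)%MS & edge s (row i L) = 0] }.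

(** A column of cokermx N gives a linear form that vanishes on N and not at y,
    along which s can be modified. *)
Lemma lincomb_extend s (N : 'M_n) y v : ~~ (y <= N)%MS ->
  exists s', (forall u, (u <= N)%MS -> lincomb s' u = lincomb s u) /\ lincomb s' y = v.
Proof.
rewrite submxE => nz; have [j yj] : exists j, (y *m cokermx N) 0 j != 0.
  apply: contrapT => no; case/eqP: nz; apply/rowP => j; rewrite [RHS]mxE.
  by apply/eqP; apply: contrapT => /negP h; apply: no; exists j.
set z := (y *m cokermx N) 0 j in yj.
pose xi i := z^-1 * cokermx N i j.
pose s' i := s i + xi i *: (v - lincomb s y).
have evs' u : lincomb s' u = lincomb s u + (z^-1 * (u *m cokermx N) 0 j) *: (v - lincomb s y).
  rewrite /lincomb /s'; under eq_bigr => i _ do rewrite scalerDr scalerA.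
  rewrite big_split /= -scaler_suml; congr (_ + _ *: _).
  by rewrite !mxE mulr_sumr; apply: eq_bigr => i _; rewrite mulrCA.
exists s'; split=> [u|]; rewrite evs'; first by rewrite submxE => /eqP ->; rewrite mxE mulr0 scale0r addr0.
by rewrite -/z mulVf // scale1r addrC subrK.
Qed.

(** If a combination l of edges labelled x has exactly one end in N, the other
    end y is a new dimension, and s may be given at y the only value that makes
    it compatible along l. Then y joins N and l joins L. *)
Lemma partial_section_extend k N s (L : 'M_(k, m)) x l y v :
    partial_section N s L -> one_label t x l -> ~~ (y <= N)%MS ->
    (y = l *m tgt_mx K t /\ (l *m src_mx K t <= N)%MS /\ v = ract (gen x) (lincomb s (l *m src_mx K t))) \/
    (y = l *m src_mx K t /\ (l *m tgt_mx K t <= N)%MS /\ v = ract (geni x) (lincomb s (l *m tgt_mx K t))) ->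
  exists k' N' s' (L' : 'M_(k', m)), (\rank N < \rank N')%N /\ partial_section N' s' L'.
Proof.
move=> G hl yN hy; have [s' [es' ey]] := lincomb_extend s v yN.
have NN' : (N <= N + y)%MS by apply: addsmxSl.
have yN' : (y <= N + y)%MS by apply: addsmxSr.
have rkN : (\rank (N + y)%MS <= (\rank N).+1)%N.
  by case: (mxrank_adds_leqif N y) => le _; have := rank_leq_row y; lia.
have rkN2 : (\rank N < \rank (N + y)%MS)%N.
  have := mxrank_leqif_sup NN'; case=> le; rewrite ltn_neqAle le andbT => ->.
  by apply: contra yN; apply: submx_trans.
have lN : (l *m src_mx K t <= N + y)%MS /\ (l *m tgt_mx K t <= N + y)%MS.
  case: hy => [[<- [h _]]|[<- [h _]]]; split=> //; exact: submx_trans h NN'.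
have edgel : edge s' l = 0.
  rewrite (edge_one_label _ hl); case: hy => [[e [h ve]]|[e [h ve]]].
    by rewrite -e ey es' // ve subrr.
  by rewrite -e ey es' // ve ractM geniK ract1 subrr.
have prlv : row_app v = avec y.
  case: hy => [[-> [h ->]]|[-> [h ->]]].
    by rewrite row_app_ract (ps_row_app G) // (vec_one_label hl).
  by rewrite row_app_ract (ps_row_app G) // (vec_one_label hl) -mulrA genK mulr1.
have LN (M : 'M_(m, n)) : (forall i, (row i L *m M <= N)%MS) -> (L *m M <= N)%MS.
  by move=> h; apply/row_subP => i; rewrite row_mul.
(* Both ends of the rows of L are in N while one end of l is not, so l is
   independent of L. *)
have lL : ~~ (l <= L)%MS.
  apply: contra yN => lL; case: hy => -[-> _]; apply: submx_trans (submxMr _ lL) _;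
    by apply: LN => i; have [z []] := ps_row G i.
exists (k + 1)%N, (N + y)%MS, s', (col_mx L l); split=> //; split.
- exact: submx_trans (ps_a G) NN'.
- exact: submx_trans (ps_b G) NN'.
- by rewrite es' ?(ps_sa G) //; exact: ps_a G.
- by rewrite es' ?(ps_sb G) //; exact: ps_b G.
- move=> u /sub_addsmxP[[c d] /= ->].
  have [d' ->] : exists d', d = d'%:M by exists (d 0 0); apply: mx11_scalar.
  have cN : (c *m N <= N)%MS by apply: submxMl.
  by rewrite mul_scalar_mx !lincombD !lincombZ ey es' // row_appD row_appZ prlv (ps_row_app G) // /avec lincombD lincombZ.
- rewrite /row_free eqn_leq rank_leq_row /= -addsmxE addn1.
  have := ps_free G; rewrite /row_free => /eqP {1}<-.
  have := mxrank_leqif_sup (addsmxSl L l); case=> le; rewrite ltn_neqAle le andbT => ->.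
  by apply: contra lL; apply: submx_trans; apply: addsmxSr.
- by have := ps_rank G; lia.
- move=> i; case: (splitP i) => [i' ei|i' ei].
    have -> : i = lshift 1 i' by apply: val_inj.
    rewrite rowKu; have [z [h1 h2 h3 h4]] := ps_row G i'; exists z; split=> //.
    + exact: submx_trans h2 NN'.
    + exact: submx_trans h3 NN'.
    + by rewrite (edge_one_label _ h1) !es' // -(edge_one_label _ h1).
  have -> : i = rshift k i' by apply: val_inj.
  rewrite rowKd row_id; exists x; case: lN => h1 h2; split=> //.
Qed.

Lemma partial_section_closed k N s (L : 'M_(k, m)) : partial_section N s L ->
  exists k' N' s' (L' : 'M_(k', m)), partial_section N' s' L' /\ closed_under t N'.
Proof.
have [d] := ubnP (n - \rank N)%N; elim: d k N s L => // d IH k N s L lt G.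
have [cN|ncN] := pselect (closed_under t N); first by exists k, N, s, L.
have [x [l [hl ne]]] : exists x l, one_label t x l /\ (l *m src_mx K t <= N)%MS != (l *m tgt_mx K t <= N)%MS.
  apply: contrapT => no; apply: ncN => x l hl; apply/eqP; apply: contrapT => /negP h.
  by apply: no; exists x, l.
have step y v : ~~ (y <= N)%MS ->
    (y = l *m tgt_mx K t /\ (l *m src_mx K t <= N)%MS /\ v = ract (gen x) (lincomb s (l *m src_mx K t))) \/
    (y = l *m src_mx K t /\ (l *m tgt_mx K t <= N)%MS /\ v = ract (geni x) (lincomb s (l *m tgt_mx K t))) ->
  exists k' N' s' (L' : 'M_(k', m)), partial_section N' s' L' /\ closed_under t N'.
  move=> yN hy; have [k' [N' [s' [L' [lt' G']]]]] := partial_section_extend G hl yN hy.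
  apply: IH G'; have := rank_leq_row N'; lia.
case e1 : (l *m src_mx K t <= N)%MS ne => ne.
  by apply: (step (l *m tgt_mx K t) (ract (gen x) (lincomb s (l *m src_mx K t)))); [| left].
apply: (step (l *m src_mx K t) (ract (geni x) (lincomb s (l *m tgt_mx K t)))); rewrite ?e1 //.
by right; split=> //; split=> //; move: ne; case: (_ <= _)%MS.
Qed.

Lemma partial_section_start : row_free (col_mx va vb) -> exists s, partial_section (va + vb)%MS s (0 : 'M_(0, m)).
Proof.
move=> fr; pose R := pinvmx (col_mx va vb).
have eR : col_mx va vb *m R = 1%:M by rewrite mulmxVp.
(* R is dual to the pair of independent vectors (va, vb), so s has prescribed
   values at them. *)
pose s i : V := ((R i (lshift 1 0))%:A, (R i (rshift 1 0))%:A).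
have evs u : lincomb s u = (((u *m R) 0 (lshift 1 0))%:A, ((u *m R) 0 (rshift 1 0))%:A).
  have f1 (I : Type) (r : seq I) (f : I -> V) :
      \sum_(i <- r) f i = (\sum_(i <- r) (f i).1, \sum_(i <- r) (f i).2).
    by elim: r => [|i r IH]; rewrite ?big_nil // !big_cons IH.
  by rewrite /lincomb f1 /= !mxE !scaler_suml; congr pair; apply: eq_bigr => i _; rewrite scalerA.
have vaR : va *m R = row_mx 1%:M 0.
  have := congr1 usubmx eR; rewrite -mul_usub_mx col_mxKu => ->.
  by rewrite scalar_mx_block block_mxEv col_mxKu.
have vbR : vb *m R = row_mx 0 1%:M.
  have := congr1 dsubmx eR; rewrite -mul_dsub_mx col_mxKd => ->.
  by rewrite scalar_mx_block block_mxEv col_mxKd.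
have sa : lincomb s va = (1, 0).
  by rewrite evs vaR row_mxEl row_mxEr !mxE eqxx scale1r scale0r.
have sb : lincomb s vb = (0, 1).
  by rewrite evs vbR row_mxEl row_mxEr !mxE eqxx scale1r scale0r.
exists s; split=> //.
- exact: addsmxSl.
- exact: addsmxSr.
- move=> u /sub_addsmxP[[c d] /= ->].
  have [c' ->] : exists c', c = c'%:M by exists (c 0 0); apply: mx11_scalar.
  have [d' ->] : exists d', d = d'%:M by exists (d 0 0); apply: mx11_scalar.
  rewrite !mul_scalar_mx lincombD !lincombZ sa sb /avec lincombD !lincombZ row_appD !row_appZ /row_app /=.
  by rewrite !mulr1 !mulr0 addr0 add0r.
- by rewrite /row_free mxrank0.
- by case: (mxrank_adds_leqif va vb) => le _; have := rank_leq_row va; have := rank_leq_row vb; lia.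
- by case.
Qed.

(** For a partial section whose space N is closed, hence everything, L has at
    least m - 1 independent rows in the m-dimensional space of combinations of
    edges. So the failures of compatibility along all edges are multiples of a
    single column h, which the row (a, b) kills. Following the tree from its
    root v gives s(g) = s(v) g - h c(g), and by linearity this holds for a and
    b: (1, 0) = s(v) a - h c(a) and (0, 1) = s(v) b - h c(b). The first
    coordinates are the conclusion. *)
Theorem completion :
    row_free (col_mx va vb) ->
    (forall N, closed_under t N -> (va <= N)%MS -> (vb <= N)%MS -> row_full N) ->
  exists p h c1 c2 : A,
    [/\ p * a - h * c1 = 1, p * b = h * c2 & exists y, a * h + b * y = 0].
Proof.
move=> fr full; have [s0 G0] := partial_section_start fr.
have [k [N [s [L [G cN]]]]] := partial_section_closed G0.
have fN := full N cN (ps_a G) (ps_b G).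
have subN u : (u <= N)%MS by apply: submx_full.
have prls i : row_app (s i) = io (vtx t i).
  by have := ps_row_app G (subN (delta_mx 0 i)); rewrite /avec !lincomb_delta.
(* N is everything and has dimension m.+1, which the bound on its rank turns
   into a bound on L. *)
have kL : (m <= k.+1)%N by have := ps_rank G; move: fN; rewrite /row_full => /eqP ->.
pose dl j := ract (gen (lab t j)) (s (src t j)) - s (tgt t j).
have edgeE l : edge s l = \sum_j l 0 j *: dl j by [].
have edgeD l l' : edge s (l + l') = edge s l + edge s l' by apply: lincombD.
have edgeZ c l : edge s (c *: l) = c *: edge s l by apply: lincombZ.
have edgeL l : (l <= L)%MS -> edge s l = 0.
  case/submxP => D ->; rewrite mulmx_sum_row /edge.
  rewrite [LHS](@lincomb_sum _ _ _ dl) big1 // => i _; rewrite lincombZ.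
  by have [z [_ _ _ e]] := ps_row G i; rewrite [lincomb _ _]e scaler0.
have prl0 : row_app 0 = 0 by rewrite /row_app /= !mulr0 addr0.
have prl_dl j : row_app (dl j) = 0.
  by rewrite /dl -scaleN1r row_appD row_appZ row_app_ract !prls vtxE ioM scaleN1r subrr.
have [h [eta [eh ph]]] : exists h (eta : 'I_m -> K),
    (forall j, dl j = eta j *: h) /\ row_app h = 0.
  have [all0|] := pselect (forall j, dl j = 0).
    by exists 0, (fun=> 0); split=> // j; rewrite all0 scaler0.
  case/existsNP => j0 /eqP nz; exists (dl j0).
  have dj j : edge s (delta_mx 0 j) = dl j by apply: lincomb_delta.
  have j0L : ~~ (delta_mx (0 : 'I_1) j0 <= L)%MS.
    by apply: contra nz => /edgeL; rewrite dj => ->.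
  (* One combination of edges outside L completes L to the whole space of
     edges. *)
  have fullL : row_full (L + delta_mx (0 : 'I_1) j0)%MS.
    rewrite /row_full eqn_leq rank_leq_col /=; apply: leq_trans kL _.
    have := ps_free G; rewrite /row_free => /eqP {1}<-.
    have := mxrank_leqif_sup (addsmxSl L (delta_mx (0 : 'I_1) j0)); case=> le.
    rewrite ltn_neqAle le andbT => ->.
    by apply: contra j0L; apply: submx_trans; apply: addsmxSr.
  have ex j : exists c, dl j = c *: dl j0.
    have /sub_addsmxP[[c d] /= e] := submx_full (delta_mx (0 : 'I_1) j) fullL.
    exists (d 0 0); rewrite -!dj e edgeD edgeL ?submxMl // add0r.
    by rewrite [d]mx11_scalar mul_scalar_mx edgeZ mxE eqxx mulr1n.
  by have [eta he] := choice ex; exists eta.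
have exc : forall i, exists c, s i = ract (io (vtx t i)) (s ord0) - ract c h.
  apply: (conn (t := t)
      (Q := fun i => exists c, s i = ract (io (vtx t i)) (s ord0) - ract c h)).
    by exists 0; rewrite vtx0 io1 ract1 /ract !mulr0 subr0.
  move=> j.
  have es : s (tgt t j) = ract (gen (lab t j)) (s (src t j)) - eta j *: h.
    by rewrite -eh /dl opprB addrC subrK.
  split=> -[c ec].
    exists (c * gen (lab t j) + (eta j)%:A).
    by rewrite es ec vtxE ioM ractD ractN !ractM ractDr ractZr ract1 opprD addrA.
  exists ((c - (eta j)%:A) * geni (lab t j)).
  have -> : s (src t j) = ract (geni (lab t j)) (s (tgt t j) + eta j *: h).
    by rewrite es subrK ractM genK ract1.
  rewrite ec vtxE ioM !ractD ractN !ractM -[io (fg_gen _)]/(gen _) -mulrA genK mulr1.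
  rewrite mulrBl ractDr -addrA; congr (_ + _); rewrite opprD; congr (_ + _).
  by rewrite ractNr opprK -scalerAl mul1r ractZr ractZ.
have [c ec] := choice exc.
have evs u : lincomb s u = ract (avec u) (s ord0) - ract (lincomb c u) h.
  have rmS I (r : seq I) (f : I -> A) v' :
      ract (\sum_(i <- r) f i) v' = \sum_(i <- r) ract (f i) v'.
    by apply: (big_morph (fun z => ract z v')) => [x y|]; rewrite ?ractDr // /ract !mulr0.
  rewrite /avec /lincomb !rmS -sumrB; apply: eq_bigr => i _.
  by rewrite !ractZr -scalerBr -ec.
exists (s ord0).1, h.1, (lincomb c va), (lincomb c vb); split.
- by have := ps_sa G; rewrite evs => -[].
- by have := ps_sb G; rewrite evs => -[/eqP]; rewrite subr_eq0 => /eqP.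
- by exists h.2.
Qed.
End Completion.

Section Instance.
Variables (K : fieldType) (T : choiceType).
Local Notation F := (free_group T).
Local Notation A := (group_algebra K F).

Lemma vec_surj m (t : tree T m) (a : A) :
  (forall g, g \in supp a -> exists i, vtx t i = g) -> exists v, vec t v = a.
Proof.
move=> h.
have hi g : exists i, g \in supp a -> vtx t i = g.
  have [ga|ga] := boolP (g \in supp a); last by exists ord0.
  by have [i] := h g ga; exists i.
have [i ei] := choice hi.
exists (\sum_(g <- supp a) co g a *: delta_mx 0 (i g)).
rewrite /vec lincomb_sum [RHS]monalgE; apply: eq_big_seq => g ga.
rewrite lincombZ lincomb_delta (ei _ ga); apply: coP => z.
by rewrite coZ [in RHS]coU [in LHS]co_of mulr_natr.
Qed.

(** The supports of a and b lie in a finite tree, whose closed subspaces that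
    contain a and b are everything as 1 is in the right ideal generated by a
    and b. *)
Lemma unimodular_completion (a b p q : A) : a * p + b * q = 1 ->
    (forall c d : K, (forall g, c * co g a + d * co g b = 0) -> c = 0 /\ d = 0) ->
  exists p' h c1 c2 y : A, [/\ p' * a - h * c1 = 1, p' * b = h * c2 & a * h + b * y = 0].
Proof.
move=> e1 indep.
have [m [t cov]] := tree_cover (supp a ++ supp b).
have [va eva] := @vec_surj _ t a (fun g ga => cov g ltac:(rewrite mem_cat ga //)).
have [vb evb] := @vec_surj _ t b (fun g ga => cov g ltac:(rewrite mem_cat ga orbT //)).
have cov_vec u g : co g (vec t u) = \sum_i u 0 i * co g (ga_of K (vtx t i)).
  by rewrite /vec /lincomb co_sum; apply: eq_bigr => i _; rewrite coZ.
have ca g : co g a = \sum_i va 0 i * co g (ga_of K (vtx t i)) by rewrite -cov_vec eva.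
have cb g : co g b = \sum_i vb 0 i * co g (ga_of K (vtx t i)) by rewrite -cov_vec evb.
have fr : row_free (col_mx va vb).
  rewrite -kermx_eq0; apply/rowV0P => u /sub_kermxP.
  rewrite -[u](@hsubmxK _ _ 1 1) mul_row_col => e.
  have [|c0 d0] := indep (lsubmx u 0 0) (rsubmx u 0 0).
    move=> g; rewrite ca cb !mulr_sumr -big_split.
    transitivity (co g (vec t (0 : 'rV[K]_m.+1))); last by rewrite /vec lincomb0 co0.
    rewrite -e (cov_vec (_ + _)); apply: eq_bigr => i _.
    by rewrite !mxE !big_ord1 /= mulrDl !mulrA !mxE.
  rewrite [lsubmx u]mx11_scalar [rsubmx u]mx11_scalar c0 d0.
  by rewrite !raddf0 row_mx0.
have full N : closed_under t N -> (va <= N)%MS -> (vb <= N)%MS -> row_full N.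
  by move=> cN Na Nb; apply: (closed_full cN Na Nb (p := p) (q := q)); rewrite eva evb.
have := @completion K T m t A (@ga_of K F) (@ga_of1 K F) (@ga_ofM K F) va vb fr full.
move=> [p' [h [c1 [c2 [h1 h2 [y h3]]]]]].
rewrite [avec _ _ _]eva in h1 h3; rewrite [avec _ _ _]evb in h2 h3.
exists p', h, c1, c2, y; split; [exact: h1 | exact: h2 | exact: h3].
Qed.
End Instance.

(** * Least elements of supports *)

Section Order.
Variables (G : groupType) (H : pred G) (P : G -> Prop).
Hypotheses (sH : subgroup H) (cP : cone H P).
Implicit Types (x y z : G).
Local Open Scope group_scope.

Definition olt x y := P (x^-1 * y).

Lemma olt_total x y : H x -> H y -> [\/ x = y, olt x y | olt y x].
Proof.
move=> hx hy.
have hxy : H (x^-1 * y) by apply: (subgM sH) => //; apply: (subgV sH).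
case: (coneT cP hxy) => [e|lt|gt]; first by constructor 1; rewrite -[y](mulVKg x) e mulg1.
  by constructor 2.
by constructor 3; move: gt; rewrite /olt invgM invgK.
Qed.

Lemma olt_trans x y z : H x -> H y -> H z -> olt x y -> olt y z -> olt x z.
Proof.
move=> hx hy hz; rewrite /olt => xy yz.
have -> : x^-1 * z = (x^-1 * y) * (y^-1 * z) by rewrite -mulgA mulVKg.
by apply: (coneM cP) => //; apply: (subgM sH) => //; apply: (subgV sH).
Qed.

Lemma olt_irr x : ~ olt x x.
Proof. by rewrite /olt mulVg; apply: cone1 cP. Qed.

Lemma oltMl x y z : olt x y -> olt (z * x) (z * y).
Proof. by rewrite /olt invgM -mulgA mulKg. Qed.

Lemma oltMr x y z : H x -> H y -> H z -> olt x y -> olt (x * z) (y * z).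
Proof.
move=> hx hy hz; rewrite /olt => xy.
have -> : (x * z)^-1 * (y * z) = (x^-1 * y) ^ z by rewrite /conjg invgM !mulgA.
by apply: (coneJ cP) => //; apply: (subgM sH) => //; apply: (subgV sH).
Qed.

Lemma olt_min (s : seq G) : s <> [::] -> (forall x, x \in s -> H x) ->
  exists2 x, x \in s & forall y, y \in s -> y = x \/ olt x y.
Proof.
elim: s => // x s IH _ hs; have [->|s0] := pselect (s = [::]).
  by exists x; rewrite ?mem_head // => y; rewrite inE => /eqP; left.
have [|m ms mmin] := IH s0; first by move=> y ys; apply: hs; rewrite inE ys orbT.
have hx : H x by apply: hs; rewrite mem_head.
have hm : H m by apply: hs; rewrite inE ms orbT.
have hy y : y \in s -> H y by move=> ys; apply: hs; rewrite inE ys orbT.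
case: (olt_total hx hm) => [e|lt|gt].
- exists m; first by rewrite inE ms orbT.
  by move=> y; rewrite inE => /orP[/eqP->|/mmin//]; left.
- exists x; rewrite ?mem_head // => y; rewrite inE => /orP[/eqP->|ys]; first by left.
  case: (mmin y ys) => [->|my]; right=> //.
  by apply: (olt_trans hx hm _ lt) => //; apply: hy.
- exists m; first by rewrite inE ms orbT.
  by move=> y; rewrite inE => /orP[/eqP->|/mmin//]; right.
Qed.
End Order.

Lemma cone_opp (G : groupType) (H : pred G) (P : G -> Prop) : subgroup H ->
  cone H P -> cone H (fun x => P x^-1%g).
Proof.
move=> sH cP; split=> [|x y hx hy px py|x y hx hy px|x hx].
- by rewrite invg1; apply: cone1 cP.
- by rewrite invgM; apply: (coneM cP) => //; apply: (subgV sH).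
- by rewrite -conjVg; apply: (coneJ cP) => //; apply: (subgV sH).
- by rewrite invgK; case: (coneT cP hx) => ?; [constructor 1|constructor 3|constructor 2].
Qed.

Section Extremal.
Variables (K : fieldType) (G : groupType) (P : G -> Prop).
Hypothesis cP : cone predT P.
Local Notation A := (group_algebra K G).
Implicit Types (a b : A).

Lemma subgroup_predT : subgroup (predT : pred G). Proof. by split. Qed.

Lemma supp_min (Q : G -> Prop) a : cone predT Q -> a <> 0 -> exists2 x, x \in supp a &
  forall y, y \in supp a -> y = x \/ olt Q x y.
Proof.
move=> cQ a0; apply: (olt_min subgroup_predT cQ) => // e; apply: a0; apply: coP => g.
rewrite co0; apply/eqP; apply: contrapT => /negP; rewrite -suppE.
by rewrite [_ \in _](_ : _ = (g \in (supp a : seq G))) // e.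
Qed.

(** Strict monotonicity on both sides makes x * y the product of only one pair
    of elements of the supports. *)
Lemma co_min a b (Q : G -> Prop) x y : cone predT Q ->
    (forall x', x' \in supp a -> x' = x \/ olt Q x x') ->
    (forall y', y' \in supp b -> y' = y \/ olt Q y y') ->
    x \in supp a ->
  co (x * y)%g (a * b) = co x a * co y b.
Proof.
move=> cQ xm ym xa; rewrite coM (big_fsetD1 _ xa) /= mulKg big1_seq ?addr0 // => z /andP[_].
rewrite in_fsetD1 => /andP[/eqP ne za].
have [->|nz] := eqVneq (co (z^-1 * (x * y))%g b) 0; first by rewrite mulr0.
rewrite -suppE in nz; case: (xm _ za) => // xz.
have e : (z * (z^-1 * (x * y)) = x * y)%g by rewrite mulVKg.
have lt1 : olt Q (x * y)%g (z * y)%g by apply: (oltMr subgroup_predT cQ).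
case: (ym _ nz) => [e1|lt]; first by rewrite e1 in e; move: lt1; rewrite e => /(olt_irr cQ).
have := olt_trans subgroup_predT cQ isT isT isT lt1 (oltMl z lt); rewrite e.
by move/(olt_irr cQ).
Qed.

Lemma ga_integral a b : a <> 0 -> b <> 0 -> a * b <> 0.
Proof.
move=> a0 b0 e; have [x xa xm] := supp_min cP a0; have [y yb ym] := supp_min cP b0.
have := co_min cP xm ym xa; rewrite e co0 => /esym/eqP; rewrite mulf_eq0.
by rewrite !suppE in xa yb; rewrite (negbTE xa) (negbTE yb).
Qed.

(** In an order, the product of the least elements of the two supports is in
    the support of a * b, hence of a, so the least element of the support of b
    is at least 1. The opposite order gives that it is at most 1. *)
Lemma supp_sub_scalar a b : a * b <> 0 -> {subset supp (a * b) <= supp a} ->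
  forall y, y \in supp b -> y = 1%g.
Proof.
move=> ab0 sub.
have a0 : a <> 0 by move=> e; apply: ab0; rewrite e mul0r.
have b0 : b <> 0 by move=> e; apply: ab0; rewrite e mulr0.
have ext (Q : G -> Prop) : cone predT Q -> forall y, y \in supp b -> y = 1%g \/ Q y.
  move=> cQ y yb; have [x xa xm] := supp_min cQ a0; have [y0 y0b ym] := supp_min cQ b0.
  have xy : (x * y0)%g \in supp a.
    apply: sub; rewrite suppE (co_min cQ xm ym xa) mulf_neq0 // -suppE //.
  have [y01|Qy0] : y0 = 1%g \/ Q y0.
    case: (xm _ xy) => [e|]; last by rewrite /olt mulKg; right.
    by left; apply: (mulgI x); rewrite e mulg1.
  - by case: (ym _ yb) => [->|]; [left | rewrite /olt y01 invg1 mul1g; right].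
  case: (ym _ yb) => [->|h]; first by right.
  by right; rewrite -[y](mulVKg y0); apply: (coneM cQ).
move=> y yb; case: (ext _ cP y yb) => // Py; case: (ext _ (cone_opp subgroup_predT cP) y yb) => // PVy.
case: (cone1 cP); rewrite -(mulgV y); exact: (coneM cP).
Qed.
End Extremal.

(** * Scalars in a group algebra *)

Section Scalars.
Variables (K : fieldType) (G : groupType).
Local Notation A := (group_algebra K G).
Implicit Types (a b : A).

Definition ga_scal (c : K) : A := mkmalgU 1%g c.
Lemma co_scal z c : co z (ga_scal c) = c *+ (1%g == z). Proof. exact: coU. Qed.
Lemma supp_scal c : {subset supp (ga_scal c) <= [fset 1%g]%fset}.
Proof. by move=> x; rewrite suppE co_scal inE; case: (1%g =P x) => [<-|_]; rewrite ?mulr0n eqxx. Qed.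
Lemma co_scalMl z c a : co z (ga_scal c * a) = c * co z a.
Proof. by rewrite (coMw _ _ (@supp_scal c)) big_seq_fset1 co_scal eqxx invg1 mul1g. Qed.
Lemma co_scalMr z c a : co z (a * ga_scal c) = co z a * c.
Proof. by rewrite (coMrw _ _ (@supp_scal c)) big_seq_fset1 co_scal eqxx invg1 mulg1. Qed.
Lemma supp1_scal a : (forall y, y \in supp a -> y = 1%g) -> a = ga_scal (co 1%g a).
Proof.
move=> h; apply: coP => z; rewrite co_scal; case: (1%g =P z) => [<-|ne]; first by rewrite mulr1n.
by apply/eqP; rewrite mulr0n; apply: contrapT => /negP; rewrite -suppE => /h /esym.
Qed.
Lemma supp1 z : z \in supp (1 : A) -> z = 1%g.
Proof. by rewrite suppE co1; case: (1%g =P z) => // _; rewrite eqxx. Qed.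
Lemma supp_of (g z : G) : z \in supp (ga_of K g) -> z = g.
Proof. by rewrite suppE co_of; case: (g =P z) => // _; rewrite eqxx. Qed.
Lemma suppD a b z : z \in supp (a + b) -> z \in supp a \/ z \in supp b.
Proof.
rewrite !suppE coD; have [->|] := eqVneq (co z a) 0; last by left.
by rewrite add0r; right.
Qed.
Lemma suppN a z : z \in supp (- a) -> z \in supp a.
Proof. by rewrite !suppE coN oppr_eq0. Qed.
Lemma suppB a b z : z \in supp (a - b) -> z \in supp a \/ z \in supp b.
Proof. by case/suppD => [|/suppN]; [left|right]. Qed.
Lemma supp0 a : (forall z, z \notin supp a) -> a = 0.
Proof. by move=> h; apply: coP => z; rewrite co0; apply/eqP; rewrite -[_ == _]negbK -suppE h. Qed.
Definition supp_in (S : pred G) a := forall z, z \in supp a -> S z.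
End Scalars.

(** * The right annihilator of f modulo w - 1 *)

Section RingIdentities.
Variable R : nzRingType.
Implicit Types (f b p q h g x y z c u v : R).

(** Expand x = (p f - h c1) x and replace f x by b y. *)
Lemma annihilator_principal f b p h c1 c2 x y :
  p * f - h * c1 = 1 -> p * b = h * c2 -> f * x = b * y -> x = h * (c2 * y - c1 * x).
Proof.
by move=> e1 e2 e3; rewrite mulrBr !mulrA -e2 -[p * b * y]mulrA -e3 mulrA -mulrBl e1 mul1r.
Qed.

Lemma annihilator_comm f b p q : f * p + b * q = 1 -> f * (p * b) = b * (1 - q * b).
Proof. by move/(canRL (addrK _)) => e; rewrite mulrA e mulrBl mul1r mulrBr mulr1 mulrA. Qed.

Lemma annihilator_idem f b p q : f * p + b * q = 1 -> f * (1 - p * f) = b * (q * f).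
Proof.
move/(canRL (addrK _)) => e; rewrite mulrBr mulr1 (mulrA f) e mulrBl mul1r -mulrA.
by rewrite opprB addrC subrK.
Qed.

Lemma subr_addC u x z : u - x = z -> x + z = u.
Proof. by move=> <-; rewrite addrC subrK. Qed.

Lemma mulrK_inv h u v : v * u = 1 -> h * v * u = h.
Proof. by move=> e; rewrite -mulrA e mulr1. Qed.

Lemma factor_through g u h z x : g * u = h -> x = h * z -> x = g * (u * z).
Proof. by move=> <- ->; rewrite mulrA. Qed.

Lemma mulrA_eq f h v b y : f * h = b * y -> f * (h * v) = b * (y * v).
Proof. by rewrite !mulrA => ->. Qed.

Lemma mulr0_inv p f h c1 b c2 : h = 0 -> p * f - h * c1 = 1 -> p * b = h * c2 ->
  p * f = 1 /\ p * b = 0.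
Proof. by move=> ->; rewrite !mul0r subr0. Qed.
End RingIdentities.

Section Annihilator.
Variables (K : fieldType) (T : countType).
Local Notation F := (free_group T).
Local Notation A := (group_algebra K F).
Variables (H : pred F) (w : F) (f p q : A).
Hypotheses (sH : subgroup H) (Hw : H w) (w1 : w <> 1%g).
Hypotheses (fH : supp_in H f) (e1 : f * p + (ga_of K w - 1) * q = 1).
Hypothesis indep : forall c d : K,
  (forall g, c * co g f + d * co g (ga_of K w - 1) = 0) -> c = 0 /\ d = 0.
Local Notation b := (ga_of K w - 1).

Lemma supp_in_gen : supp_in H b.
Proof.
move=> z /suppB[/supp_of->//|/supp1->]; exact: subg1 sH.
Qed.

Lemma gen_neq0 : b <> 0.
Proof.
move/(congr1 (co w)); rewrite coB co_of co1 eqxx co0.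
by case: (1%g =P w) => [/esym//|_] /eqP; rewrite subr0 oner_eq0.
Qed.

Lemma res_mull (S : pred F) x (a : A) : (forall u z, H u -> S (u * z)%g = S z) -> supp_in H x ->
  res S (x * a) = x * res S a.
Proof.
move=> hS xH; rewrite (@resM K F S predT S x a) ?(@res_id K F predT x) // => u z ux _ /=.
by rewrite hS //; apply: xH.
Qed.

Lemma subgroup_memMl u z : H u -> H (u * z)%g = H z.
Proof.
move=> hu; apply/idP/idP => [h|]; last exact: (subgM sH).
by rewrite -[z](mulKg u); apply: (subgM sH) => //; apply: (subgV sH).
Qed.

Lemma supp_in_res (S : pred F) (a : A) : supp_in S (res S a).
Proof. by move=> z; rewrite supp_res => /andP[]. Qed.

Lemma supp_inM (x y : A) : supp_in H x -> supp_in H y -> supp_in H (x * y).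
Proof. by move=> hx hy z /suppM[u [v [/hx hu /hy hv ->]]]; apply: (subgM sH). Qed.
Lemma supp_inB (x y : A) : supp_in H x -> supp_in H y -> supp_in H (x - y).
Proof. by move=> hx hy z /suppB[/hx|/hy]. Qed.
Lemma supp_in1 : supp_in H (1 : A).
Proof. by move=> z /supp1 ->; exact: subg1 sH. Qed.

(** Restriction of supports to a right coset of H preserves the annihilator h
    A, because f and b are supported in H. So the part of h on the coset of one
    of its elements m is h z, and z is a scalar by supp_sub_scalar: h is
    supported in H m. After translation h is supported in H, and then so are
    the cofactors once restricted to H. *)
Lemma annihilator_supported : exists p' h g R y : A,
  [/\ [/\ supp_in H p', supp_in H h, supp_in H g, supp_in H R & supp_in H y],
      p' * f + h * g = 1, p' * b = h * R & f * h = b * y].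
Proof.
have [p1 [h [c1 [c2 [y0 [a1 a2 a3]]]]]] := unimodular_completion e1 indep.
have fh : f * h = b * - y0 by rewrite (mulrN b y0); apply/eqP; rewrite -(addr_eq0 (f * h)) a3.
have gen x y : f * x = b * y -> exists z, x = h * z.
  by move=> e; eexists; apply: (annihilator_principal a1 a2 e).
have h0 : h <> 0.
  move=> h0; have [a4 a5] := mulr0_inv h0 a1 a2.
  apply: (ga_integral (@magnus_pos_cone T) _ gen_neq0 a5) => p10.
  by move/(congr1 (co 1%g)): a4; rewrite p10 (mul0r f) co0 co1 eqxx => /esym/eqP; rewrite oner_eq0.
have [m mh _] := supp_min (@magnus_pos_cone T) h0.
(* The right coset of H that contains m. *)
pose S x := H (x * m^-1)%g.
have hS u z : H u -> S (u * z)%g = S z by move=> hu; rewrite /S -mulgA subgroup_memMl.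
have hSh : supp_in S h.
  have [z ez] : exists z, res S h = h * z.
    apply: (gen _ (res S (- y0))); apply: etrans (esym (res_mull h hS fH)) _.
    exact: etrans (congr1 (res S) fh) (res_mull (- y0) hS supp_in_gen).
  have mS : m \in supp (res S h) by rewrite supp_res mh /S mulgV (subg1 sH).
  have hz0 : h * z <> 0 by move=> e; move: mS; rewrite ez e suppE co0 eqxx.
  have z1 : z = ga_scal F (co 1%g z).
    apply: supp1_scal; apply: (supp_sub_scalar (@magnus_pos_cone T) hz0) => u.
    by rewrite -ez supp_res => /andP[].
  have c1' : co 1%g z = 1.
    have cm : co m h != 0 by rewrite -suppE.
    apply: (mulfI cm); rewrite mulr1 -(co_scalMr m (co 1%g z) h) -z1 -ez co_res.
    by rewrite /S mulgV (subg1 sH).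
  have -> : h = res S h by rewrite ez z1 c1'; apply: coP => u; rewrite co_scalMr mulr1.
  exact: supp_in_res.
(* The support of h is now known to lie in H m. *)
pose h' := h * ga_of K m^-1%g.
have hh' : h' * ga_of K m = h by apply: mulrK_inv; rewrite -ga_ofM mulVg ga_of1.
have h'H : supp_in H h'.
  move=> z; rewrite suppE /h' co_Mr invgK -suppE => /hSh.
  by rewrite /S mulgK.
have gen' x y : supp_in H x -> f * x = b * y -> exists2 z, supp_in H z & x = h' * z.
  move=> xH /gen[z ez]; exists (res H (ga_of K m * z)); first exact: supp_in_res.
  have ex := congr1 (res H) (factor_through hh' ez); rewrite (res_id xH) in ex.
  exact: etrans ex (res_mull (ga_of K m * z) subgroup_memMl h'H).
pose p' := res H p; pose q' := res H q.
have e2 : f * p' + b * q' = 1.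
  apply: etrans (congr2 +%R (esym (res_mull p subgroup_memMl fH)) (esym (res_mull q subgroup_memMl supp_in_gen))) _.
  apply: etrans (esym (resD _ _ _)) (etrans (congr1 (res H) e1) (res_id supp_in1)).
have p'H : supp_in H p' by apply: supp_in_res.
have [R RH eR] : exists2 R, supp_in H R & p' * b = h' * R.
  exact: (gen' _ _ (supp_inM p'H supp_in_gen) (annihilator_comm e2)).
have [g gH eg] : exists2 g, supp_in H g & 1 - p' * f = h' * g.
  exact: (gen' _ _ (supp_inB supp_in1 (supp_inM p'H fH)) (annihilator_idem e2)).
have [y yH ey] : exists2 y, supp_in H y & f * h' = b * y.
  exists (res H (- y0 * ga_of K m^-1%g)); first exact: supp_in_res.
  apply: etrans (res_mull (- y0 * ga_of K m^-1%g) subgroup_memMl supp_in_gen).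
  exact: etrans (esym (res_id (supp_inM fH h'H))) (congr1 (res H) (mulrA_eq _ fh)).
exists p', h', g, R, y; split; [by split | exact: subr_addC eg | exact: eR | exact: ey].
Qed.
End Annihilator.

(** * Homogeneity of the annihilator *)

(** A character is invariant under conjugation, so its lexicographic refinement
    by a bi-order still is. *)
Lemma cone_lex (G : groupType) (H : pred G) (P : G -> Prop) (phi : G -> int) :
  subgroup H -> cone predT P -> hom_on H phi ->
  cone H (fun x => 0 < phi x \/ phi x = 0 /\ P x).
Proof.
move=> sH cP hom.
have phi1 := hom_on1 sH hom; have phiV x := @hom_onV G H phi x sH hom.
split=> [[|[_]]|x y hx hy|x y hx hy|x hx].
- by rewrite phi1 ltxx.
- exact: cone1 cP.
- rewrite hom // => -[px|[px Px]] [py|[py Py]]; try (by left; lia).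
  by right; split; [rewrite px py addr0 | apply: (coneM cP)].
- have -> : phi (x ^ y)%g = phi x.
    by rewrite /conjg !hom ?phiV //; [lia | exact: (subgV sH) | exact: (subgM sH)].
  case=> [px|[px Px]]; [by left | by right; split=> //; apply: (coneJ cP)].
- case: (ltgtP 0 (phi x)) => [lt|gt|/esym e].
  + by constructor 2; left.
  + by constructor 3; left; rewrite phiV // oppr_gt0.
  + case: (coneT cP (x := x) isT) => [->|Px|Px]; first by constructor 1.
      by constructor 2; right.
    by constructor 3; right; rewrite phiV // e oppr0.
Qed.

Lemma eventually_all (X : eqType) (s : seq X) (P : X -> nat -> Prop) :
  (forall x, x \in s -> exists N, forall k, (N <= k)%N -> P x k) ->
  exists N, forall x, x \in s -> forall k, (N <= k)%N -> P x k.
Proof.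
elim: s => [|x s IH] h; first by exists 0%N.
have [N1 h1] := h x (mem_head _ _).
have [|N2 h2] := IH; first by move=> y ys; apply: h; rewrite inE ys orbT.
exists (maxn N1 N2) => y; rewrite inE => /orP[/eqP->|ys] k; rewrite geq_max => /andP[l1 l2].
  exact: h1.
exact: h2.
Qed.

Section Geometric.
Variable R : nzRingType.
Implicit Types (x f p h g r : R).

(** The geometric series in x turns p (x - 1) = h r into a right inverse of h,
    up to the remainder p x^N f. *)
Lemma geometric_inverse x f p h g r N : p * f + h * g = 1 -> p * (x - 1) = h * r ->
  h * (g - r * (\sum_(k < N) x ^+ k) * f) = 1 - p * x ^+ N * f.
Proof.
move=> e1 e2; rewrite mulrBr !mulrA -e2 -[p * (x - 1) * _]mulrA -subrX1.
by rewrite mulrBr mulr1 mulrBl opprB addrA [h * g + _]addrC e1.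
Qed.
Lemma geometric_sum r f x N : r * (\sum_(k < N) x ^+ k) * f = \sum_(k < N) r * x ^+ k * f.
Proof. by rewrite mulr_sumr mulr_suml. Qed.
End Geometric.

Lemma fg_expg_inj (T : countType) (w : free_group T) i j :
  w <> 1%g -> (w ^+ i)%g = (w ^+ j)%g -> i = j.
Proof.
move=> /magnus_depth[s [s0 ms es]] e; have hi : magnus (w ^+ i)%g s = i%:Z * magnus w s := magnus_zpow i s0 es.
have hj : magnus (w ^+ j)%g s = j%:Z * magnus w s := magnus_zpow j s0 es.
by move: hi; rewrite e hj => /(mulIf ms) [].
Qed.

Section Inverse.
Variables (K : fieldType) (T : countType).
Local Notation F := (free_group T).
Local Notation A := (group_algebra K F).
Variables (H : pred F) (w : F) (f p g h r : A).
Hypotheses (sH : subgroup H) (Hw : H w) (w1 : w <> 1%g).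
Hypotheses (fH : supp_in H f) (gH : supp_in H g) (hH : supp_in H h) (rH : supp_in H r).

Lemma ga_ofX n : (ga_of K w : A) ^+ n = ga_of K (w ^+ n)%g.
Proof.
elim: n => [|n IH]; first by rewrite expr0 expg0 ga_of1.
by rewrite expgS (ga_ofM K w (w ^+ n)%g) -IH; exact: exprS.
Qed.

(** The terms of the series in the right inverse of h. *)
Definition power_term (a b : A) k := a * (ga_of K w : A) ^+ k * b.

Lemma supp_power_term a b k z : z \in supp (power_term a b k) ->
  exists x y, [/\ x \in supp a, y \in supp b & z = (x * w ^+ k * y)%g].
Proof.
rewrite /power_term ga_ofX => /suppM[u [y [/suppM[x [v [xa /supp_of -> ->]]] yb ->]]].
by exists x, y; split; [exact: xa | exact: yb |].
Qed.

(** A product a w^k b has no fixed element z in its support for large k, since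
    the powers of w are distinct. The formal right inverse of h therefore
    exists coefficientwise. *)
Lemma power_term_vanish a b z : exists N, forall k, (N <= k)%N -> co z (power_term a b k) = 0.
Proof.
have [|N hN] := @eventually_all _ [seq (x, y) | x <- supp a, y <- supp b]
    (fun xy k => z <> (xy.1 * w ^+ k * xy.2)%g).
  move=> [x y] _ /=.
  have [[k0 ek]|no] := pselect (exists k, z = (x * w ^+ k * y)%g); last first.
    by exists 0%N => k _ e; apply: no; exists k.
  exists k0.+1 => k lt; rewrite ek => /mulIg/mulgI/(fg_expg_inj w1); lia.
exists N => k lt; apply/eqP; apply: contrapT => /negP; rewrite -suppE.
case/supp_power_term => x [y [xa yb ez]]; apply: (hN (x, y) _ k lt) ez.
exact: allpairs_f.
Qed.

Definition inv_approx N : A := g - r * (\sum_(k < N) (ga_of K w : A) ^+ k) * f.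

Lemma co_inv_approx z N : co z (inv_approx N) = co z g - \sum_(k < N) co z (power_term r f k).
Proof. by rewrite /inv_approx coB geometric_sum co_sum. Qed.

Lemma mul_inv_approx N : p * f + h * g = 1 -> p * (ga_of K w - 1) = h * r ->
  h * inv_approx N = 1 - power_term p f N.
Proof. exact: geometric_inverse. Qed.

(** The approximations differ by the terms of the series, so each coefficient
    is eventually constant. *)
Lemma inv_limit_exists z : exists v, exists N, forall n, (N <= n)%N -> co z (inv_approx n) = v.
Proof.
have [N hN] := power_term_vanish r f z; exists (co z (inv_approx N)), N => n le.
apply: etrans (co_inv_approx z n) (etrans _ (esym (co_inv_approx z N))); congr (_ - _).
have tail (u : nat -> K) : (forall k, (N <= k)%N -> u k = 0) ->
    \sum_(k < n) u k = \sum_(k < N) u k.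
  move=> u0; rewrite -(subnKC le) big_split_ord /= [X in _ + X]big1 ?addr0 //.
  by move=> i _; apply: u0; rewrite leq_addr.
exact: tail hN.
Qed.

Lemma inv_limit_conv (Q : F -> K) z :
    (forall z, exists N, forall n, (N <= n)%N -> co z (inv_approx n) = Q z) ->
    p * f + h * g = 1 -> p * (ga_of K w - 1) = h * r ->
  \sum_(x <- supp h) co x h * Q (x^-1 * z)%g = (1%g == z)%:R.
Proof.
move=> hQ.
have [|N hN] := @eventually_all _ (supp h : seq F)
    (fun x n => co (x^-1 * z)%g (inv_approx n) = Q (x^-1 * z)%g).
  by move=> x _; have [N h'] := hQ (x^-1 * z)%g; exists N.
have [N2 hN2] := power_term_vanish p f z.
pose M := maxn N N2.
have -> : \sum_(x <- supp h) co x h * Q (x^-1 * z)%g = co z (h * inv_approx M).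
  by rewrite coM; apply: eq_big_seq => x xh; rewrite hN // leq_maxl.
have hz : co z (1 - power_term p f M) = (1%g == z)%:R.
  by rewrite coB co1 hN2 ?subr0 // leq_maxr.
move=> e1 e2; exact: etrans (congr1 (co z) (mul_inv_approx M e1 e2)) hz.
Qed.

Lemma inv_limit_supp (Q : F -> K) z :
    (forall z, exists N, forall n, (N <= n)%N -> co z (inv_approx n) = Q z) ->
  Q z != 0 -> z \in supp g \/
    exists x y k, [/\ x \in supp r, y \in supp f & z = (x * w ^+ k * y)%g].
Proof.
move=> hQ; have [N hN] := hQ z; rewrite -(hN N) // co_inv_approx => nz.
have [zg|zg] := boolP (z \in supp g); [by left | right].
have [k tk] : exists k : 'I_N, co z (power_term r f k) != 0.
  apply: contrapT => no; case/eqP: nz; move: zg; rewrite suppE negbK => /eqP ->.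
  rewrite big1 ?subr0 // => k _; apply/eqP; apply: contrapT => /negP h'.
  by apply: no; exists k.
rewrite -suppE in tk; have [x [y [xr yf ez]]] := supp_power_term tk.
by exists x, y, k.
Qed.

(** The support of Q may be infinite, but in each family x w^k y the first
    member that occurs is the least, as w is positive. There are finitely many
    families, so Q has a least element. Its product with the least element of
    the support of h occurs in h Q = 1 without cancellation, so it is 1. *)
Lemma least_inverse (Q : F -> K) (P : F -> Prop) : cone H P -> P w ->
    (forall z, exists N, forall n, (N <= n)%N -> co z (inv_approx n) = Q z) ->
    (forall z, \sum_(x <- supp h) co x h * Q (x^-1 * z)%g = (1%g == z)%:R) ->
  exists x z, [/\ x \in supp h, Q z != 0, (x * z)%g = 1%g,
    forall x', x' \in supp h -> x' = x \/ olt P x x' &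
    forall z', Q z' != 0 -> z' = z \/ olt P z z'].
Proof.
move=> cP Pw hQ conv.
have HQ z : Q z != 0 -> H z.
  case/(inv_limit_supp hQ) => [/gH//|[x [y [k [/rH hx /fH hy ->]]]]].
  by apply: (subgM sH) => //; apply: (subgM sH) => //; apply: subgX.
have [z1 Qz1] : exists z, Q z != 0.
  apply: contrapT => no; have := conv 1%g; rewrite eqxx big1_seq => [/esym/eqP|x _].
    by rewrite oner_eq0.
  by rewrite (_ : Q _ = 0) ?mulr0 //; apply/eqP; apply: contrapT => /negP h'; apply: no; eexists; exact: h'.
have h0 : (supp h : seq F) <> [::].
  move=> e; have := conv 1%g; rewrite e big_nil eqxx => /esym/eqP; by rewrite oner_eq0.
have [x xh xm] := olt_min sH cP h0 (fun x hx => hH hx).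
have Pk k : (0 < k)%N -> P (w ^+ k)%g.
  case: k => // k _; elim: k => [|k IH]; first by rewrite expg1.
  by rewrite expgS; apply: (coneM cP) => //; apply: subgX.
(* The list c xy has at most one element, the least member of the family of xy
   at which Q does not vanish. *)
have least xy : exists c : seq F, (forall z, z \in c -> Q z != 0) /\
    forall k, H xy.1 -> H xy.2 -> Q (xy.1 * w ^+ k * xy.2)%g != 0 ->
      exists2 z, z \in c & (xy.1 * w ^+ k * xy.2)%g = z \/ olt P z (xy.1 * w ^+ k * xy.2)%g.
  case: xy => u v /=.
  have [ex|no] := pselect (exists k, Q (u * w ^+ k * v)%g != 0); last first.
    by exists [::]; split=> // k _ _ nz; case: no; exists k.
  case: (ex_minnP ex) => k0 nz0 min0.
  exists [:: (u * w ^+ k0 * v)%g]; split=> [z|k Hu Hv nz]; first by rewrite inE => /eqP->.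
  exists (u * w ^+ k0 * v)%g; rewrite ?mem_head //.
  have := min0 _ nz; rewrite leq_eqVlt => /orP[/eqP <-|lt]; [by left | right].
  rewrite -(subnKC (ltnW lt)) expgnDr mulgA.
  apply: (oltMr sH cP) => //; try by do ?[apply: (subgM sH) => //]; apply: subgX.
  by rewrite /olt mulKg; apply: Pk; rewrite subn_gt0.
have [c hc] := choice least.
pose cand := [seq z <- supp g | Q z != 0] ++
   flatten [seq c xy | xy <- [seq (x, y) | x <- supp r, y <- supp f]].
have candQ z : z \in cand -> Q z != 0.
  rewrite mem_cat => /orP[|/flatten_mapP[xy _ zc]]; first by rewrite mem_filter => /andP[].
  by have [h1 _] := hc xy; apply: h1.
have candP z : Q z != 0 -> exists2 z', z' \in cand & z = z' \/ olt P z' z.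
  move=> nz; case: (inv_limit_supp hQ nz) => [zg|[u [v [k [ur vf ez]]]]].
    by exists z; [rewrite mem_cat mem_filter nz zg | left].
  have [_ h2] := hc (u, v); rewrite ez in nz *.
  have [z' z'c hz'] := h2 k (rH ur) (fH vf) nz; exists z' => //.
  rewrite mem_cat; apply/orP; right; apply/flatten_mapP; exists (u, v) => //.
  exact: allpairs_f.
have cand0 : cand <> [::].
  by have [z' z'c _] := candP _ Qz1; move=> e; rewrite e in z'c.
have [z zc zm] := olt_min sH cP cand0 (fun z hz => HQ z (candQ z hz)).
have Qz := candQ _ zc.
have zmin z' : Q z' != 0 -> z' = z \/ olt P z z'.
  move=> nz; have [z2 z2c e] := candP _ nz; have h2 := HQ _ (candQ _ z2c).
  case: (zm _ z2c) e => [->//|lt] [->|lt2]; right=> //.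
  by apply: (olt_trans sH cP _ _ _ lt lt2) => //; apply: HQ.
have Hx := hH xh; have Hz := HQ _ Qz.
exists x, z; split=> //.
have := conv (x * z)%g; rewrite (big_fsetD1 _ xh) /= mulKg big1_seq ?addr0 => [e|y /andP[_]].
  apply/esym/eqP; move: e; case: (1%g == _) => // e.
  by move/eqP: e; rewrite mulf_eq0 -[co x h == 0]negbK -suppE xh (negbTE Qz).
rewrite in_fsetD1 => /andP[/eqP ne yh].
have [->|nz] := eqVneq (Q (y^-1 * (x * z))%g) 0; first by rewrite mulr0.
case: (xm _ yh) => // xy; have Hy := hH yh.
have e : (y * (y^-1 * (x * z)) = x * z)%g by rewrite mulVKg.
have lt1 : olt P (x * z)%g (y * z)%g by apply: (oltMr sH cP).
have Hxz : H (x * z)%g by apply: (subgM sH).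
have Hyz : H (y * z)%g by apply: (subgM sH).
case: (zmin _ nz) => [ez|lt]; first by rewrite ez in e; move: lt1; rewrite e => /(olt_irr cP).
have := olt_trans sH cP Hxz Hyz _ lt1 (oltMl y lt); rewrite e => /(_ Hxz).
by move/(olt_irr cP).
Qed.
End Inverse.

Section Homogeneous.
Variables (K : fieldType) (T : countType).
Local Notation F := (free_group T).
Local Notation A := (group_algebra K F).
Variables (H : pred F) (w : F) (f p g h r : A).
Hypotheses (sH : subgroup H) (Hw : H w) (w1 : w <> 1%g).
Hypotheses (fH : supp_in H f) (gH : supp_in H g) (hH : supp_in H h) (rH : supp_in H r).

Lemma positive_cone : exists2 P : F -> Prop, cone predT P & P w.
Proof.
have sT' := subgroup_predT F.
case: (magnus_pos_total w) => [//|pw|pw]; first by exists (@magnus_pos T) => //; exact: magnus_pos_cone.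
by exists (fun x => magnus_pos x^-1%g) => //; apply: cone_opp => //; exact: magnus_pos_cone.
Qed.

(** The order refining phi gives x0 and z0 where phi is least on the supports
    of h and of Q, with opposite values; the order refining - phi gives x1 and
    z1 where phi is greatest on them, again with opposite values. Then the
    greatest value on the support of h is phi x1 = - phi z1 <= - phi z0 = phi
    x0, the least one. *)
Lemma annihilator_homogeneous (phi : F -> int) : hom_on H phi -> phi w = 0 ->
    p * f + h * g = 1 -> p * (ga_of K w - 1) = h * r ->
  forall x y, x \in supp h -> y \in supp h -> phi x = phi y.
Proof.
move=> hom phiw e1 e2.
have [Q hQ] := choice (inv_limit_exists f g r Hw w1).
have conv z := inv_limit_conv Hw w1 z hQ e1 e2.
move: e1 e2 => _ _.
have [P cP Pw] := positive_cone.
have homN : hom_on H (fun x => - phi x).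
  by move=> x y hx hy; rewrite hom // opprD.
have least (psi : F -> int) : hom_on H psi -> psi w = 0 -> exists x z,
   [/\ x \in supp h, Q z != 0, H z, psi x + psi z = 0 &
    (forall x', x' \in supp h -> psi x <= psi x') /\ forall z', Q z' != 0 -> psi z <= psi z'].
  move=> hpsi psiw; pose L x := 0 < psi x \/ psi x = 0 /\ P x.
  have cL : cone H L := cone_lex sH cP hpsi.
  have Lw : L w by right.
  have [x [z [xh Qz xz xm zm]]] := least_inverse sH Hw fH gH hH rH cL Lw hQ conv.
  have HQ u : Q u != 0 -> H u.
    case/(inv_limit_supp hQ) => [/gH//|[x' [y [k [/rH hx /fH hy ->]]]]].
    by apply: (subgM sH) => //; apply: (subgM sH) => //; apply: subgX.
  have mono u v : H u -> H v -> v = u \/ olt L u v -> psi u <= psi v.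
    move=> hu hv [->//|]; have e : psi (u^-1 * v)%g = psi v - psi u.
      by rewrite hpsi ?(hom_onV sH hpsi) //; [lia | exact: (subgV sH)].
    by rewrite /olt /L e => -[|[]]; lia.
  have hx := hH xh; have hz := HQ _ Qz.
  exists x, z; split=> //; first by rewrite -hpsi // xz (hom_on1 sH hpsi).
  split=> [x' x'h|z' Qz'].
    by apply: mono => //; [exact: hH | exact: xm].
  by apply: mono => //; [exact: HQ | exact: zm].
have [x0 [z0 [x0h Qz0 _ s0 [m0 n0]]]] := least phi hom phiw.
have [|x1 [z1 [x1h Qz1 _ s1 [m1 n1]]]] := least _ homN; first by rewrite phiw oppr0.
move=> x y xh yh; have := m0 _ xh; have := m0 _ yh; have := m1 _ xh; have := m1 _ yh.
have := n0 _ Qz1; have := n1 _ Qz0; lia.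
Qed.
End Homogeneous.

(** * The right ideal of w - 1 and the cosets of <w> *)

Section IdealIdentities.
Variable R : nzRingType.
Implicit Types (a b f h g p r u v x y z : R).
Lemma ideal_sub a b x y z : x = b * y -> z = b * a -> x - z = b * (y - a).
Proof. by move=> -> ->; rewrite mulrBr. Qed.
Lemma ideal_mul b x y u : x = b * y -> x * u = b * (y * u).
Proof. by move=> ->; rewrite mulrA. Qed.

(** A change of f modulo b A and a multiplication by a unit preserve the
    relation f p + b q = 1. *)
Lemma bezout_shift b f g p q y u v : f * p + b * q = 1 -> f - g = b * y -> u * v = 1 ->
  g * u * (v * p) + b * (q + y * p) = 1.
Proof.
move=> e1 e2 e3; rewrite mulrA -[g * u * v]mulrA e3 mulr1 mulrDr (mulrA b) -e2 mulrBl.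
by rewrite addrCA [g * p + _]addrC subrK addrC.
Qed.
Lemma fixed_shift b h p r u v : p * b = h * r -> u * h = b * v -> u * p * b = b * (v * r).
Proof. by rewrite -mulrA => ->; rewrite !mulrA => ->. Qed.

(** If u h and u p - x lie in b A, multiply 1 = p f + h g by u: then u is
    congruent to x f. *)
Lemma fixed_combine b f h g p x u v y : p * f + h * g = 1 -> u * h = b * y ->
   u * p - x = b * v -> u - x * f = b * (v * f + y * g).
Proof.
move=> e1 e2 e3; rewrite mulrDr !mulrA -e2 -e3 mulrBl -[u in LHS]mulr1 -e1 mulrDr !mulrA.
by rewrite addrAC.
Qed.
Lemma inv_mul x y x' y' :
  x' * x = 1 -> y' * y = 1 -> y' * x' * (x * y) = 1.
Proof. by move=> ex ey; rewrite -mulrA (mulrA x') ex mul1r. Qed.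
End IdealIdentities.

Section Cosets.
Variables (K : fieldType) (T : countType).
Local Notation F := (free_group T).
Local Notation A := (group_algebra K F).
Variable (w : F).
Local Notation b := (ga_of K w - 1 : A).
Implicit Types (a x y : A) (u v g : F).

Definition in_ideal a := exists y, a = b * y.

(** The elements of the support lie in distinct right cosets <w>u. The quotient
    by (w - 1) A is the permutation module on these cosets, so such elements
    are reduced forms for its classes. *)
Definition distinct_cosets a := forall u v, u \in supp a -> v \in supp a ->
  (exists z, v = (zpow w z * u)%g) -> u = v.

Lemma in_idealB x y : in_ideal x -> in_ideal y -> in_ideal (x - y).
Proof. by move=> [u hu] [v hv]; eexists; exact: ideal_sub hu hv. Qed.
Lemma in_ideal0 : in_ideal 0.
Proof. by exists 0; rewrite mulr0. Qed.
Lemma in_idealN x : in_ideal x -> in_ideal (- x).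
Proof. by move=> h; rewrite -[- x]add0r; apply: in_idealB in_ideal0 h. Qed.
Lemma in_idealD x y : in_ideal x -> in_ideal y -> in_ideal (x + y).
Proof. by move=> hx hy; rewrite -[y]opprK; apply: in_idealB hx (in_idealN hy). Qed.
Lemma in_idealM x y : in_ideal x -> in_ideal (x * y).
Proof. by move=> [u hu]; eexists; exact: ideal_mul hu. Qed.

Lemma in_ideal_pow z : in_ideal (ga_of K (zpow w z) - 1).
Proof.
have nat_case n : in_ideal (ga_of K (w ^+ n)%g - 1).
  by rewrite -ga_ofX; exists (\sum_(k < n) (ga_of K w : A) ^+ k); exact: subrX1.
case: z => n; first exact: nat_case.
have -> : ga_of K (zpow w (Negz n)) - 1 =
    - ((ga_of K (w ^+ n.+1)%g - 1) * ga_of K (zpow w (Negz n))).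
  rewrite mulrBl mul1r -ga_ofM /= mulgV ga_of1 opprB //.
exact/in_idealN/in_idealM.
Qed.

(** The sum of the coefficients on S. For S a right coset of <w> it is a
    coordinate of the class modulo (w - 1) A. *)
Definition augm (S : pred F) a : K := \sum_(u <- supp a) co u a * (S u)%:R.

Lemma augmE S a : augm S a = @ga_lift K F K^o (fun u => (S u)%:R) a.
Proof. by []. Qed.

Lemma augmB S x y : augm S (x - y) = augm S x - augm S y.
Proof.
have D (u v : A) : augm S (u + v) = augm S u + augm S v by rewrite !augmE ga_liftD.
apply/eqP; rewrite eq_sym subr_eq -D; apply/eqP; congr augm.
by rewrite (subrK y x).
Qed.

Lemma augm_sum S I (r : seq I) (f : I -> A) :
  augm S (\sum_(i <- r) f i) = \sum_(i <- r) augm S (f i).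
Proof. exact: (@ga_lift_sum K F K^o (fun u => (S u)%:R)). Qed.

Lemma augmU S u c : augm S (mkmalgU u c : A) = c * (S u)%:R.
Proof. exact: (@ga_liftU K F K^o (fun u => (S u)%:R)). Qed.

Lemma augm_Ml S u a : augm S (ga_of K u * a) = augm (fun v => S (u * v)%g) a.
Proof.
rewrite [a in LHS]monalgE (mulr_sumr _ _ _ (ga_of K u)) augm_sum; apply: eq_bigr => v _.
have -> : ga_of K u * (mkmalgU v (mcoeff v a) : A) = mkmalgU (u * v)%g (mcoeff v a).
  by apply: etrans (ga_mulUU _ _ _ _) _; rewrite mul1r.
by rewrite augmU.
Qed.

Lemma augm_Mr S u a : augm S (a * ga_of K u) = augm (fun v => S (v * u)%g) a.
Proof.
rewrite [a in LHS]monalgE (mulr_suml _ _ _ (ga_of K u)) augm_sum; apply: eq_bigr => v _.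
have -> : (mkmalgU v (mcoeff v a) : A) * ga_of K u = mkmalgU (v * u)%g (mcoeff v a).
  by apply: etrans (ga_mulUU _ _ _ _) _; rewrite mulr1.
by rewrite augmU.
Qed.

Lemma eq_augm S S' a : S =1 S' -> augm S a = augm S' a.
Proof. by move=> e; apply: eq_bigr => u _; rewrite e. Qed.

Lemma augm_ideal S a : (forall u, S (w * u)%g = S u) -> in_ideal a -> augm S a = 0.
Proof.
move=> Sw [y ->]; have -> : b * y = ga_of K w * y - y by rewrite mulrBl mul1r.
by rewrite augmB augm_Ml (eq_augm _ Sw) subrr.
Qed.

Definition coset g : pred F := fun u => `[< exists z, u = (zpow w z * g)%g >].

Lemma cosetP g u : reflect (exists z, u = (zpow w z * g)%g) (coset g u).
Proof. exact: asboolP. Qed.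

Lemma coset_refl g : coset g g.
Proof. by apply/cosetP; exists 0; rewrite zpow0 mul1g. Qed.

Lemma coset_w g u : coset g (w * u)%g = coset g u.
Proof.
apply/cosetP/cosetP => -[z e]; last by exists (1 + z); rewrite zpowD zpow1 -mulgA -e.
by exists (- 1 + z); rewrite zpowD zpowN zpow1 -mulgA -e mulKg.
Qed.

Lemma augm_distinct a g : distinct_cosets a -> g \in supp a -> augm (coset g) a = co g a.
Proof.
move=> da xa; rewrite /augm (big_fsetD1 _ xa) /= coset_refl mulr1 big1_seq ?addr0 // => u /andP[_].
rewrite in_fsetD1 => /andP[/eqP ne ua]; case: cosetP => [h|_]; last by rewrite mulr0.
by case: ne; rewrite (da g u).
Qed.

Lemma distinct_cosets_ideal0 a : distinct_cosets a -> in_ideal a -> a = 0.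
Proof.
move=> da ia; apply: supp0 => x; apply/negP => xa.
by move: (xa); rewrite suppE -(augm_distinct da xa) (augm_ideal (coset_w x) ia) eqxx.
Qed.

Lemma in_ideal_coset u z : in_ideal (ga_of K (zpow w z * u)%g - ga_of K u).
Proof.
have -> : ga_of K (zpow w z * u)%g - ga_of K u = (ga_of K (zpow w z) - 1) * ga_of K u.
  by rewrite mulrBl mul1r -ga_ofM.
exact/in_idealM/in_ideal_pow.
Qed.

(** Whenever u and w^z u both occur in the support, the second can be replaced
    by the first. *)
Lemma distinct_cosets_representative a : exists a', in_ideal (a - a') /\ distinct_cosets a'.
Proof.
have [n] := ubnP #|` supp a|; elim: n a => // n IH a lt.
have [da|nda] := pselect (distinct_cosets a); first by exists a; split=> //; rewrite subrr; exact: in_ideal0.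
have [u [v [ua va uv [z ev]]]] : exists u v, [/\ u \in supp a, v \in supp a, u <> v &
    exists z, v = (zpow w z * u)%g].
  apply: contrapT => no; apply: nda => u v ua va e; apply: contrapT => ne.
  by apply: no; exists u, v.
(* Subtracting t moves the coefficient at v to u. *)
pose t : A := (ga_of K v - ga_of K u) * ga_scal F (co v a).
have it : in_ideal t by rewrite /t ev; apply/in_idealM/in_ideal_coset.
have cot (x : F) : co x (a - t) = co x a - ((v == x)%:R - (u == x)%:R) * co v a.
  by rewrite coB /t co_scalMr coB !co_of.
have sub : (supp (a - t) `<=` supp a `\ v)%fset.
  apply/fsubsetP => x; rewrite in_fsetD1 !suppE cot.
  case: (v =P x) => [<-|nvx].
    by rewrite (introF eqP uv) !(mulr0n, mulr1n) subr0 mul1r subrr => /eqP.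
  have -> : x != v by apply/eqP => e; apply: nvx.
  case: (u =P x) => [<-|_]; first by rewrite -!suppE ua.
  by rewrite !mulr0n subrr mul0r subr0.
have [|a' [ia' da']] := IH (a - t).
  apply: leq_ltn_trans (fsubset_leq_card sub) _.
  by move: lt; rewrite (cardfsD1 v) va add1n.
exists a'; split=> //; have -> : a - a' = t + (a - t - a').
  by rewrite addrA [t + _]addrC subrK.
exact: in_idealD.
Qed.

(** In the permutation module on the right cosets of <w>, an element fixed by w
    has a finite support stable under w. If the coset of g occurs then so do
    all those of g w^-k, two of them coincide, and g^-1 conjugates a nontrivial
    power of w into <w>. So g lies in <w> because w is a non-power. *)
Lemma fixed_scalar a : w <> 1%g -> non_power w -> in_ideal (a * b) ->
  exists c, in_ideal (a - ga_scal F c).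
Proof.
move=> w1 np iab; have [a' [ia da]] := distinct_cosets_representative a.
have iab' : in_ideal (a' * b).
  have -> : a' * b = a * b - (a - a') * b by rewrite -mulrBl subKr.
  exact/in_idealB/in_idealM.
(* The coordinates of the class of a are invariant under right multiplication
   by w. *)
have epsw g : augm (coset (g * w^-1)%g) a' = augm (coset g) a'.
  have := augm_ideal (coset_w g) iab'.
  have -> : a' * b = a' * ga_of K w - a' by rewrite mulrBr mulr1.
  rewrite augmB augm_Mr => /eqP; rewrite subr_eq0 => /eqP <-; apply: eq_augm => u.
  apply/cosetP/cosetP => -[z e]; exists z; first by rewrite e mulgA mulgVK.
  by rewrite mulgA -e mulgK.
have epswk g k : augm (coset (g * w ^- k)%g) a' = augm (coset g) a'.
  elim: k => [|k IH]; first by rewrite expg0 invg1 mulg1.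
  by rewrite expgS invgM mulgA epsw.
have incyc g : g \in supp a' -> exists z, g = zpow w z.
  move=> ga.
  have hits k : exists u, u \in supp a' /\ exists z, u = (zpow w z * (g * w ^- k))%g.
    apply: contrapT => no; move: (ga); rewrite suppE -(augm_distinct da ga) -(epswk g k).
    rewrite /augm big1_seq ?eqxx // => u /andP[_ ua]; case: cosetP => [h|_]; last by rewrite mulr0.
    by case: no; exists u.
  have [s hs] := choice hits.
  (* The support is finite, so two of the cosets of the g w^-k are represented
     by the same element. *)
  have [i [j [lt e]]] : exists i j, (i < j)%N /\ s i = s j.
    pose n := #|` supp a'|.
    have dup : ~~ uniq [seq s k | k <- iota 0 n.+1].
      apply/negP => un; have sub : {subset [seq s k | k <- iota 0 n.+1] <= supp a'}.
        by move=> u /mapP[k _ ->]; case: (hs k).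
      by have := uniq_leq_size un sub; rewrite size_map size_iota ltnn.
    have [x0] : exists x0 : F, True by exists 1%g.
    case/(uniqPn x0): dup => i [j [lt]]; rewrite size_map size_iota => jn e.
    exists i, j; split=> //; move: e.
    by rewrite !(nth_map 0%N) ?size_iota ?nth_iota // (ltn_trans lt).
  have [_ [z1 e1]] := hs i; have [_ [z2 e2]] := hs j.
  have [||||z ez] := @non_power_malnormal T w g^-1%g (j - i) (- z1 + z2); rewrite ?subn_gt0 //.
    have e3 : (g * w ^- i = zpow w (- z1 + z2) * (g * w ^- j))%g.
      by rewrite zpowD zpowN -mulgA -e2 -e e1 mulKg.
    have -> : (w ^+ (j - i) = w ^- i * w ^+ j)%g.
      by rewrite -[in RHS](subnKC (ltnW lt)) expgnDr mulKg.
    by rewrite /conjg invgK mulgA mulgA e3 -!mulgA mulKg mulgV mulg1.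
  by exists (- z); rewrite zpowN -ez invgK.
have [[u ua]|no] := pselect (exists u, u \in supp a'); last first.
  have a0 : a' = 0 by apply: supp0 => u; apply/negP => ua; apply: no; exists u.
  exists 0; have -> : ga_scal F 0 = 0 :> A by exact: monalgU0.
  by move: ia; rewrite a0.
have [z ez] := incyc u ua; exists (co u a').
have only v : v \in supp a' -> v = u.
  move=> va; have [z' ez'] := incyc v va; apply/esym/(da u v ua va).
  by exists (z' - z); rewrite zpowD zpowN ez' ez mulgVK.
have ea : a' = ga_of K u * ga_scal F (co u a').
  apply: coP => v; rewrite co_scalMr co_of; case: (u =P v) => [<-|ne]; first by rewrite mul1r.
  by rewrite mul0r; apply/eqP; apply: contrapT => /negP; rewrite -suppE => /only /esym.
have iu : in_ideal (ga_of K u - 1) by rewrite ez; exact: in_ideal_pow.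
have -> : a - ga_scal F (co u a') = (a - a') + (ga_of K u - 1) * ga_scal F (co u a').
  by rewrite mulrBl mul1r -ea addrA subrK.
exact: (in_idealD ia (in_idealM (ga_scal F (co u a')) iu)).
Qed.
End Cosets.

(** * Characters vanish on the support of a generator *)

Section Vanishing.
Variables (K : fieldType) (T : countType).
Local Notation F := (free_group T).
Local Notation A := (group_algebra K F).
Variables (H : pred F) (w : F) (f p g h r y : A).
Hypotheses (sH : subgroup H) (Hw : H w) (w1 : w <> 1%g) (npw : non_power w).
Hypotheses (fH : supp_in H f) (gH : supp_in H g) (hH : supp_in H h) (rH : supp_in H r) (yH : supp_in H y).
Local Notation b := (ga_of K w - 1 : A).

(** Since h is homogeneous of degree d for phi and b of degree 0, the part of
    degree d of f h = b y only involves the part of degree 0 of f. *)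
Lemma annihilator_components (phi : F -> int) (d : int) : hom_on H phi -> phi w = 0 ->
    (forall x, x \in supp h -> phi x = d) -> f * h = b * y ->
  exists v, res (fun x => phi x == 0) f * h = b * v.
Proof.
move=> hom phiw hd.
have e1 : res (fun x => phi x == d) (f * h) = res (fun x => phi x == 0) f * h.
  apply: resMl => u z uf zh; rewrite (hom _ _ (fH uf) (hH zh)) (hd z zh).
  by rewrite -[X in _ == X]add0r (inj_eq (addIr d)).
have e2 : res (fun x => phi x == d) (b * y) = b * res (fun x => phi x == d) y.
  apply: resMr => u z ub zy; have hz := yH zy.
  by case/suppB: ub => [/supp_of|/supp1] ->; rewrite ?mul1g // hom // phiw add0r.
move=> e; exists (res (fun x => phi x == d) y).
exact: etrans (esym e1) (etrans (congr1 _ e) e2).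
Qed.

(** The part u of f of degree 0 is congruent to c f for a scalar c. Both have
    their support in that of f, so they are equal; the coefficient at 1 gives c
    = 1 and u = f. *)
Lemma hom_vanishes (phi : F -> int) : hom_on H phi -> phi w = 0 -> distinct_cosets w f ->
    1%g \in supp f -> p * f + h * g = 1 -> p * b = h * r -> f * h = b * y ->
  forall x, x \in supp f -> phi x = 0.
Proof.
move=> hom phiw df f1 e1 e2 e3.
have [d hd] : exists d, forall x, x \in supp h -> phi x = d.
  have [[x0 x0h]|no] := pselect (exists x, x \in supp h).
    exists (phi x0) => x xh.
    exact: (annihilator_homogeneous sH Hw w1 fH gH hH rH hom phiw e1 e2 xh x0h).
  by exists 0 => x xh; case: no; exists x.
have [v ev] := annihilator_components hom phiw hd e3.
set u := res (fun x => phi x == 0) f in ev.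
have [c [t et]] := fixed_scalar w1 npw (ex_intro _ (v * r) (fixed_shift e2 ev)).
have uf := fixed_combine e1 ev et.
move: e1 e2 e3 ev et => _ _ _ _ _.
have cou x : co x (u - ga_scal F c * f) = (if phi x == 0 then co x f else 0) - c * co x f.
  by rewrite coB co_scalMl co_res.
have sub x : x \in supp (u - ga_scal F c * f) -> x \in supp f.
  by rewrite !suppE cou; apply: contra => /eqP->; rewrite if_same mulr0 subr0.
have u0 : u - ga_scal F c * f = 0.
  apply: (@distinct_cosets_ideal0 K T w); last by eexists; exact: uf.
  by move=> x z /sub xf /sub zf; exact: df.
have cE x : (if phi x == 0 then co x f else 0) = c * co x f.
  by apply/eqP; rewrite -subr_eq0 -cou u0 co0.
(* The coefficient of f at 1 is nonzero and survives in u. *)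
have c1 : c = 1.
  have := cE 1%g; rewrite (hom_on1 sH hom) eqxx => e.
  by apply: (mulIf (x := co 1%g f)); rewrite ?mul1r // -suppE.
move=> x xf; apply/eqP; move: (cE x); rewrite c1 mul1r; case: eqP => // _ /esym/eqP.
by move: xf; rewrite suppE => /negbTE->.
Qed.
End Vanishing.

Section Generated.
Variables (G : groupType) (X : G -> Prop).
Inductive gen_by : G -> Prop :=
| gen_mem x of X x : gen_by x
| gen_one : gen_by 1%g
| gen_mul x y of gen_by x & gen_by y : gen_by (x * y)%g
| gen_inv x of gen_by x : gen_by x^-1%g.
Definition generated : pred G := fun x => `[< gen_by x >].
Lemma generated_subgroup : subgroup generated.
Proof.
split; first by apply/asboolP; exact: gen_one.
  by move=> x y /asboolP hx /asboolP hy; apply/asboolP; exact: gen_mul.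
by move=> x /asboolP hx; apply/asboolP; exact: gen_inv.
Qed.
Lemma mem_generated x : X x -> generated x.
Proof. by move=> h; apply/asboolP; exact: gen_mem. Qed.
Lemma generated_hom0 (phi : G -> int) : hom_on generated phi ->
  (forall x, X x -> phi x = 0) -> forall x, generated x -> phi x = 0.
Proof.
move=> hom h x /asboolP; elim=> [z /h //||u v gu eu gv ev|u gu eu].
- exact: hom_on1 generated_subgroup hom.
- by rewrite hom ?eu ?ev ?addr0 //; apply/asboolP.
by rewrite (hom_onV generated_subgroup hom) ?eu ?oppr0 //; apply/asboolP.
Qed.
End Generated.

(** * Generators are trivial units modulo w - 1 *)

Section Generators.
Variables (K : fieldType) (T : countType) (w : free_group T).
Local Notation F := (free_group T).
Local Notation A := (group_algebra K F).
Hypotheses (w1 : w <> 1%g) (npw : non_power w).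
Local Notation b := (ga_of K w - 1 : A).

(** A linear relation between f and w - 1 would put f in the ideal of w - 1, so
    f would be 0. *)
Lemma distinct_indep (f : A) : distinct_cosets w f -> 1%g \in supp f ->
  forall c d : K, (forall g, c * co g f + d * co g b = 0) -> c = 0 /\ d = 0.
Proof.
move=> df f1 c d h; have c0 : c = 0.
  apply: contrapT => /eqP cn.
  have ef : f = b * ga_scal F (- d / c).
    apply: coP => g; rewrite co_scalMr.
    move: (co g f) (co g b) (h g) => x z hg; apply: (mulfI cn).
    by rewrite (canRL (addrK _) hg) sub0r; field.
  have f0 : f = 0 by apply: (@distinct_cosets_ideal0 K T w) => //; eexists; exact: ef.
  by move: f1; rewrite f0 suppE co0 eqxx.
split=> //; have := h w; rewrite c0 mul0r add0r coB co_of co1 eqxx.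
by case: (1%g =P w) => [/esym//|_]; rewrite subr0 mulr1.
Qed.

(** Every character of the subgroup H generated by w and the support of f that
    kills w vanishes on the support of f by hom_vanishes, hence on H. So
    isolator applies: the support lies in the centralizer of w, which is the
    coset <w> of 1. *)
Lemma normalized_generator (f p q : A) : distinct_cosets w f -> 1%g \in supp f ->
  f * p + b * q = 1 -> f = ga_scal F (co 1%g f).
Proof.
move=> df f1 e; pose X x := x = w \/ x \in supp f; pose H := generated X.
have sH : subgroup H := generated_subgroup X.
have Hw : H w by apply: mem_generated; left.
have fH : supp_in H f by move=> x xf; apply: mem_generated; right.
have [p' [h [g [R [y [[pH hH gH RH yH] e1 e2 e3]]]]]] :=
  annihilator_supported sH Hw w1 fH e (distinct_indep df f1).
have van (phi : F -> int) : hom_on H phi -> phi w = 0 -> forall x, H x -> phi x = 0.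
  move=> hom phiw; apply: (generated_hom0 hom) => x [->//|].
  exact: (hom_vanishes sH Hw w1 npw fH gH hH RH yH hom phiw df f1 e1 e2 e3).
move: e e1 e2 e3 => _ _ _ _; apply: supp1_scal => x xf.
have [M M0 hM] := isolator sH Hw w1 van.
have [z ez] := hM x (fH x xf).
have [z' ez'] : exists z', x = zpow w z'.
  apply: non_power_centralizer => //; apply: (fg_commute_root M0); rewrite ez.
  by rewrite /commute -[in LHS](zpow1 w) -[in RHS](zpow1 w) -!zpowD addrC.
by apply/esym; apply: df => //; exists z'; rewrite mulg1.
Qed.

Lemma generator_trivial_unit (f p q : A) : f * p + b * q = 1 ->
  exists c m, c != 0 /\ in_ideal w (f - ga_scal F c * ga_of K m).
Proof.
move=> e; have [f1 [i1 d1]] := distinct_cosets_representative w f; have [t et] := i1.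
have [m mf1] : exists m, m \in supp f1.
  apply: contrapT => no; have f10 : f1 = 0.
    by apply: supp0 => x; apply/negP => xf; apply: no; exists x.
  (* If f were in the ideal, so would be 1, whose augmentation is not zero. *)
  have i1' : in_ideal w (1 : A).
    exists (t * p + q); rewrite mulrDr mulrA -et f10 subr0; exact: esym e.
  have : augm predT (1 : A) = 0 by apply: (@augm_ideal K T w).
  by rewrite -ga_of1 augmU mulr1 => /eqP; rewrite oner_eq0.
have mm : ga_of K m^-1%g * ga_of K m = 1 :> A by rewrite -ga_ofM mulVg.
have e' := bezout_shift e et mm.
set f2 := f1 * ga_of K m^-1%g in e'.
have sf2 x : (x \in supp f2) = ((x * m)%g \in supp f1) by rewrite suppE co_Mr invgK -suppE.
have f2E : f2 = ga_scal F (co 1%g f2).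
  apply: (normalized_generator _ _ e'); last by rewrite sf2 mul1g.
  move=> u v; rewrite !sf2 => uf vf [z ez]; apply: (mulIg m).
  by apply: d1 => //; exists z; rewrite ez mulgA.
move: e e' => _ _; exists (co 1%g f2), m; split; first by rewrite -suppE sf2 mul1g.
rewrite -f2E /f2 -mulrA mm mulr1; exact: i1.
Qed.

Lemma trivial_unit (c : K) m : c != 0 -> ga_scal F c * ga_of K m \is a GRing.unit.
Proof.
move=> c0; apply: (@ga_unitP K F _ (ga_of K m^-1%g * ga_scal F c^-1)).
have scalM (d d' : K) : d * d' = 1 -> ga_scal F d * ga_scal F d' = 1.
  by move=> e; apply: etrans (ga_mulUU _ _ _ _) _; rewrite e mulg1.
have gaV (u v : F) : (u * v)%g = 1%g -> ga_of K u * ga_of K v = 1.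
  by move=> e; rewrite -ga_ofM e.
split; apply: inv_mul.
- by apply: scalM; rewrite mulVf.
- by apply: gaV; rewrite mulVg.
- by apply: gaV; rewrite mulgV.
by apply: scalM; rewrite mulfV.
Qed.
End Generators.

Theorem theorem5p4 (K : finFieldType) (r : nat) (r_ge1 : (1 <= r)%N)
    (w : free_group 'I_r) (w_neq1 : w <> 1%g) (w_np : non_power w)
    (f : rquot (ga_of K w - 1)) :
  cyclic_generator f ->
  exists2 u : group_algebra K (free_group 'I_r),
    u \is a GRing.unit & f = rproj (ga_of K w - 1) u.
Proof.
move=> gf; have [f0 ef] := rproj_surj f.
have [p] := gf (rproj _ 1); rewrite ef -rprojM => /rproj_eq[q e].
have e1 : f0 * p + (ga_of K w - 1) * q = 1 by rewrite -e addrC subrK.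
have [c [m [c0 [t et]]]] := generator_trivial_unit w_neq1 w_np e1.
exists (ga_scal _ c * ga_of K m); first exact: trivial_unit.
by apply/rproj_eq; exists t.
Qed.
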